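(* Let $P$ be an $r$-gon and let $\mathbb{R}\mathcal{Z}_{K_P}$ be its real moment angle manifold. Then $\mathrm{cat}(\mathbb{R}\mathcal{Z}_{K_P}) = 3$.
   Context: For a simplicial complex $K$ with vertex set $[r]=\{1,\dots,r\}$ and a simplex $\sigma\in K$, put $(D^1,S^0)^\sigma=\{(x_1,\dots,x_r)\in(D^1)^r \mid x_i\in S^0 \text{ when } i\notin\sigma\}$, where $D^1=[-1,1]$ and $S^0=\{-1,1\}$. The real moment angle complex of $K$ is $\mathbb{R}\mathcal{Z}_K=\bigcup_{\sigma\in K}(D^1,S^0)^\sigma\subseteq(D^1)^r$. For a simple polytope $P$ with facets $F_1,\dots,F_r$, $K_P$ is the simplicial complex on $\{1,\dots,r\}$ whose simplices are the sets $\{i_1,\dots,i_k\}$ with $F_{i_1}\cap\cdots\cap F_{i_k}\neq\emptyset$; $\mathbb{R}\mathcal{Z}_{K_P}$ is a manifold, called the real moment angle manifold of $P$. LS-category (non-normalized): $\mathrm{cat}(Y)$ is the least positive number of open sets $U$ needed to cover $Y$ such that each inclusion $U\hookrightarrow Y$ is homotopic in $Y$ to a constant map ($\infty$ if no such finite cover exists).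
   Formalization: The formal statement assumes r ≥ 4; for r = 3 the claim fails, since the real moment angle manifold of a triangle is the boundary of the cube [-1,1]^3, a 2-sphere, whose non-normalized cat is 2. *)

(* Defs.v *)
From mathcomp Require Import all_boot all_order all_algebra.
From mathcomp Require Import all_classical all_reals all_analysis.

Set Implicit Arguments.
Unset Strict Implicit.
Unset Printing Implicit Defensive.

Import Order.TTheory GRing.Theory Num.Theory.
Import numFieldNormedType.Exports.

Local Open Scope classical_set_scope.
Local Open Scope ring_scope.

Definition is_polytope (R : realType) (n : nat) (P : set 'rV[R]_n) : Prop :=
  exists s : seq 'rV[R]_n, P = smallest (@convex_set R 'rV[R]_n) [set` s].

(* [A] contains [k + 1] affinely independent points. *)
Definition affdim_ge (R : realType) (n : nat) (A : set 'rV[R]_n) (k : nat) :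
    Prop :=
  exists p : 'I_k.+1 -> 'rV[R]_n,
    (forall i, A (p i)) /\
    row_free (\matrix_(i < k) (p (lift ord0 i) - p ord0)).

Definition has_affdim (R : realType) (n : nat) (A : set 'rV[R]_n) (k : nat) :
    Prop :=
  affdim_ge A k /\ ~ affdim_ge A k.+1.

(* The improper faces are included: [c = 0] with [b = 0] gives [P] itself, and
   [c = 0] with [b = 1] gives the empty face. *)
Definition is_face (R : realType) (n : nat) (P F : set 'rV[R]_n) : Prop :=
  exists (c : 'cV[R]_n) (b : R),
    (forall x, P x -> (x *m c) 0 0 <= b) /\
    F = P `&` [set x | (x *m c) 0 0 = b].

Definition is_facet (R : realType) (n : nat) (P F : set 'rV[R]_n) : Prop :=
  is_face P F /\ exists d, has_affdim P d.+1 /\ has_affdim F d.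

(* [P] is an [r]-gon, with facets (edges) [F 0], ..., [F (r - 1)] listed in an
   arbitrary order.  Simplicity need not be required: every polygon is a simple
   polytope. *)
Definition is_gon (R : realType) (r : nat) (P : set 'rV[R]_2)
    (F : 'I_r -> set 'rV[R]_2) : Prop :=
  [/\ is_polytope P, has_affdim P 2, injective F
    & forall G, is_facet P G <-> exists i, F i = G].

(* The complex K_P.  The empty simplex belongs to it, the intersection of the
   empty family being the whole plane. *)
Definition facet_complex (R : realType) (n r : nat)
    (F : 'I_r -> set 'rV[R]_n) : set {set 'I_r} :=
  [set s : {set 'I_r} | \bigcap_(i in [set` s]) F i !=set0].

Definition disk_sphere_power (R : realType) (r : nat) (s : {set 'I_r}) :
    set 'rV[R]_r :=
  [set x | (forall i, -1 <= x 0 i <= 1) /\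
           (forall i, i \notin s -> x 0 i = -1 \/ x 0 i = 1)].
Arguments disk_sphere_power R {r} s.

Definition real_moment_angle_set (R : realType) (r : nat)
    (K : set {set 'I_r}) : set 'rV[R]_r :=
  \bigcup_(s in K) disk_sphere_power R s.
Arguments real_moment_angle_set R {r} K.

(* [set_type] carries the topology induced from R^r. *)
Definition real_moment_angle (R : realType) (r : nat) (K : set {set 'I_r}) :
    topologicalType :=
  set_type (real_moment_angle_set R K).
Arguments real_moment_angle R {r} K.

Definition homotopic (R : realType) (X Y : topologicalType) (f g : X -> Y) :
    Prop :=
  exists H : X * R -> Y,
    [/\ {within [set: X] `*` `[0, 1], continuous H},
        forall x, H (x, 0) = f x & forall x, H (x, 1) = g x].

Definition null_homotopic_in (R : realType) (Y : topologicalType)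
    (U : set Y) : Prop :=
  exists y : Y, homotopic R (set_val : U -> Y) (cst y).

Definition has_categorical_cover (R : realType) (Y : topologicalType)
    (n : nat) : Prop :=
  exists U : 'I_n -> set Y,
    (forall i, open (U i) /\ null_homotopic_in R (U i)) /\
    \bigcup_i U i = [set: Y].

(* Non-normalized: a nonempty contractible space has category 1. *)
Definition LScat (R : realType) (Y : topologicalType) : \bar nat :=
  if pselect (exists n, (0 < n)%N && `[< has_categorical_cover R Y n >])
    is left h then (ex_minn h)%:E else +oo%E.

(* Main.v *)
(** The category is at most 3 because the points of the cube complex fall into
    three open strata according to how many coordinates are smallest in absolute
    value; each stratum deforms, piece by piece, onto vertices of the cube, and
    the vertices are joined through edges.

    The category is at least 3 by a mod 2 cup product.  Let p and q be adjacent
    edges of the polygon.  The circles [x_p = 0], [x_j = -1] for [j] not adjacent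
    to p, and likewise for q, meet in exactly one point, because with more than
    three edges no edge is adjacent to both p and q.  The intersection number
    with the first circle is a locally defined cocycle which becomes a
    coboundary over any open set contractible in the surface, and likewise for
    the second.  On a fine grid a cover by two such sets makes the cup product
    of the two classes vanish, whereas it counts that single intersection
    point. *)

Require Import Defs.
From mathcomp Require Import all_boot all_order all_algebra.
From mathcomp Require Import all_classical all_reals all_analysis.
From mathcomp Require Import ring lra zify.

Set Implicit Arguments.
Unset Strict Implicit.
Unset Printing Implicit Defensive.
Import Order.TTheory GRing.Theory Num.Theory.
Import numFieldNormedType.Exports.
Local Open Scope classical_set_scope.
Local Open Scope ring_scope.

(** * Cubical cochains mod 2 on a grid *)

(** Cohomology enters only as finite data. A mod 2 class is a function of pairs of points, additive
    on triples of nearby points; on a fine grid it restricts to a cellular cocycle, and a product of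
    two classes becomes a finite sum over squares. Working mod 2 removes orientations, and the part
    of a fundamental class is played by a parity: each edge of the polygon has exactly two
    neighbours. The bound [3 < r] cannot be dropped. For a triangle the complex is the boundary of a
    cube, a sphere, whose category is 2; there the circles [x_p = 0] and [x_q = 0] meet in two
    points, and the count is even. Plane geometry serves to extract combinatorial facts about the
    edges: no three share a point, each meets exactly two others, and no three meet pairwise once
    there is a fourth. *)

Section Grid.
Variables (r N : nat) (E : rel 'I_r).
Hypotheses (N_gt0 : (0 < N)%N) (Esym : symmetric E) (Eirr : irreflexive E).
Hypothesis Eeven : forall j, ~~ odd #|[pred i | E i j]|.

Local Notation grid := {ffun 'I_r -> 'I_N.+1}.

(** [ordS] wraps from [N] to 0, which makes a step a bijection, so that sums can be reindexed by it.
    Squares, where [v i < N] and [v j < N], never see the wrap. *)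
Definition grid_step (i : 'I_r) (v : grid) : grid :=
  [ffun k => if k == i then ordS (v k) else v k].

Definition grid_extreme (x : 'I_N.+1) : bool := (x == 0 :> nat) || (x == N :> nat).

Definition grid_square (v : grid) (i j : 'I_r) : bool :=
  [&& E i j, (v i < N)%N, (v j < N)%N &
      [forall k, (k != i) ==> (k != j) ==> grid_extreme (v k)]].

(** Here [bool] is the field with two elements. Each square is counted once for [(i, j)] and once
    for [(j, i)], so a summand symmetric in the two directions cancels. *)
Definition square_sum (f : grid -> 'I_r -> 'I_r -> bool) : bool :=
  \sum_i \sum_(j | E i j) \sum_(v | grid_square v i j) f v i j.

Lemma grid_stepE i v k :
  grid_step i v k = if k == i then ordS (v k) else v k.
Proof. exact: ffunE. Qed.

Lemma grid_step_inj i : injective (grid_step i).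
Proof.
move=> v w /ffunP vw; apply/ffunP => k; have := vw k; rewrite !grid_stepE.
by case: eqP => // _; apply: (can_inj (@ordSK _)).
Qed.

Lemma grid_square_sym v i j : grid_square v i j = grid_square v j i.
Proof.
rewrite /grid_square Esym; congr andb; rewrite andbCA; do 2!congr andb.
by apply/eq_forallb => k; case: (k != i); case: (k != j).
Qed.

Lemma square_sumD f g :
  square_sum (fun v i j => f v i j + g v i j) = square_sum f + square_sum g.
Proof.
rewrite /square_sum -big_split; apply: eq_bigr => i _ /=.
rewrite -big_split; apply: eq_bigr => j _ /=.
by rewrite -big_split.
Qed.

Lemma eq_square_sum f g :
  (forall v i j, grid_square v i j -> f v i j = g v i j) ->
  square_sum f = square_sum g.
Proof.
move=> fg; apply: eq_bigr => i _; apply: eq_bigr => j _.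
by apply: eq_bigr => v /fg.
Qed.

Lemma square_sumC f :
  square_sum f = square_sum (fun v i j => f v j i).
Proof.
rewrite /square_sum (exchange_big_dep predT) //=.
apply: eq_bigr => i _; apply: eq_big => [j|j _]; first by rewrite Esym.
by apply: eq_bigl => v; exact: grid_square_sym.
Qed.

Lemma square_sum_sym f :
  (forall v i j, grid_square v i j -> f v i j = f v j i) -> square_sum f = 0.
Proof.
move=> fsym; pose F i j := \sum_(v | grid_square v i j) f v i j.
have Fsym i j : F i j = F j i.
  by apply: eq_big => [v|v /fsym//]; exact: grid_square_sym.
rewrite /square_sum.
under eq_bigr => i _ do rewrite (bigID (fun j : 'I_r => (i < j)%N)) /=.
rewrite big_split /=.
rewrite [X in X + _](exchange_big_dep predT) //=.
rewrite (_ : \sum_(i < r) _ = \sum_(i < r) \sum_(j | E i j && ~~ (i < j)%N) F i j).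
  exact: addbb.
apply: eq_bigr => i _; apply: eq_big => [j|j _]; last exact: Fsym.
rewrite Esym; have [->|nij] := eqVneq i j; first by rewrite Eirr.
by rewrite -leqNgt ltn_neqAle eq_sym nij.
Qed.

(** Telescoping along a grid line in direction [i]: an interior point ends two unit segments, so
    only the ends 0 and [N] survive mod 2. *)
Lemma sum_step (Q : pred grid) (h : grid -> bool) i :
    (forall v, Q (grid_step i v) = Q v) ->
  \sum_(v | Q v && (v i < N)%N) (h v + h (grid_step i v)) =
  \sum_(v | Q v && grid_extreme (v i)) h v.
Proof.
move=> Qs; rewrite big_split /=.
have -> : \sum_(v | Q v && (v i < N)%N) h (grid_step i v) =
          \sum_(v | Q v && (0 < v i)%N) h v.
  rewrite [RHS](reindex_inj (@grid_step_inj i)) /=; apply: eq_bigl => v.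
  rewrite Qs grid_stepE eqxx /=; congr andb.
  have := ltn_ord (v i); rewrite ltnS leq_eqVlt => /orP[/eqP->|vN].
    by rewrite ltnn modnn.
  by rewrite vN modn_small.
rewrite [X in X + _]big_mkcond [X in _ + X]big_mkcond [RHS]big_mkcond /=.
rewrite -big_split /=; apply: eq_bigr => v _.
case: (Q v) => //=; rewrite /grid_extreme.
have := ltn_ord (v i); rewrite ltnS; case: ltngtP => //= vN _.
  by case: (v i : nat) => [|n] //=; [rewrite addr0|exact: addbb].
by rewrite vN N_gt0 orbT add0r.
Qed.

(* A closed surface has no boundary: every edge of the grid lies in an even
   number of squares. *)
Lemma square_sum_boundary (g : grid -> 'I_r -> bool) :
  square_sum (fun v i j => g v j + g (grid_step i v) j) = 0.
Proof.
(* [G j] is what telescoping in direction [i] leaves. It is independent of [i], so it occurs once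
   for each of the evenly many [i] adjacent to [j]. *)
pose G j := \sum_(v : grid | (v j < N)%N &&
                   [forall k, (k != j) ==> grid_extreme (v k)]) g v j.
transitivity (\sum_i \sum_(j | E i j) G j).
  apply: eq_bigr => i _; apply: eq_bigr => j Eij.
  have nij : i != j by apply: contraTneq Eij => ->; rewrite Eirr.
  pose Q (v : grid) := (v j < N)%N &&
    [forall k, (k != i) ==> (k != j) ==> grid_extreme (v k)].
  transitivity (\sum_(v | Q v && (v i < N)%N) (g v j + g (grid_step i v) j)).
    by apply: eq_bigl => v; rewrite /grid_square Eij /= andbC.
  rewrite (@sum_step Q (fun v => g v j) i) /=; last first.
    move=> v; rewrite /Q grid_stepE eq_sym (negbTE nij); congr andb.
    by apply: eq_forallb => k; rewrite grid_stepE; case: eqP.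
  apply: eq_bigl => v; rewrite /Q -andbA; congr andb.
  apply/andP/forallP => [[/forallP ex exi] k|ex].
    by apply/implyP => kj; case: (eqVneq k i) => [->//|ki]; have := ex k; rewrite ki kj.
  split; last by have := ex i; rewrite nij.
  by apply/forallP => k; apply/implyP => _; exact: ex.
rewrite (exchange_big_dep predT) //= big1 // => j _.
rewrite sumr_const -(odd_double_half #|_|) (negbTE (Eeven j)) add0n.
by rewrite -muln2 mulrnA; exact: addbb.
Qed.

Definition grid_cocycle (a : grid -> 'I_r -> bool) : Prop :=
  forall v i j, grid_square v i j ->
    a v i + a (grid_step i v) j = a v j + a (grid_step j v) i.

Definition coboundary (f : grid -> bool) (v : grid) (i : 'I_r) : bool :=
  f v + f (grid_step i v).

(** The cubical cup product, front edge times back edge, evaluated on the sum of all squares. *)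
Definition cup_sum (a b : grid -> 'I_r -> bool) : bool :=
  square_sum (fun v i j => a v i * b (grid_step i v) j).

Lemma grid_stepC i j v :
  grid_step i (grid_step j v) = grid_step j (grid_step i v).
Proof. by apply/ffunP => k; rewrite !grid_stepE; case: eqP; case: eqP. Qed.

Lemma coboundary_cocycle f : grid_cocycle (coboundary f).
Proof.
move=> v i j _; rewrite /coboundary (grid_stepC j i).
by case: (f v); case: (f _); case: (f _); case: (f _).
Qed.

Lemma grid_cocycleD a b : grid_cocycle a -> grid_cocycle b ->
  grid_cocycle (fun v i => a v i + b v i).
Proof. by move=> ca cb v i j sq; rewrite addrACA ca// cb// addrACA. Qed.

(** Leibniz rule: up to a leftover, the sum is that of the coboundary of [f * b], which vanishes on
    a surface without boundary. The leftover [f v * (b (grid_step i v) j + b v i)] is symmetric in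
    [i] and [j] because [b] is a cocycle. *)
Lemma cup_sum_coboundaryl f b : grid_cocycle b -> cup_sum (coboundary f) b = 0.
Proof.
move=> cb; rewrite -[RHS](square_sum_boundary (fun v j => f v * b v j)).
rewrite /cup_sum /coboundary.
under [LHS]eq_square_sum do rewrite mulrDl.
rewrite !square_sumD; congr (_ + _).
have /eqP : square_sum (fun v i j => f v * (b (grid_step i v) j + b v i)) = 0.
  by apply: square_sum_sym => v i j /cb; rewrite addrC => ->; rewrite addrC.
under eq_square_sum do rewrite mulrDr.
rewrite square_sumD addr_eq0 => /eqP ->.
by rewrite [RHS]square_sumC; exact/eqP.
Qed.

Lemma cup_sum_coboundaryr a f : grid_cocycle a -> cup_sum a (coboundary f) = 0.
Proof.
move=> ca.
rewrite -[RHS](square_sum_boundary (fun v j => a v j * f (grid_step j v))).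
rewrite /cup_sum /coboundary.
under [LHS]eq_square_sum do rewrite mulrDr.
rewrite !square_sumD; congr (_ + _); first by rewrite square_sumC.
have /eqP : square_sum (fun v i j =>
    (a v i + a (grid_step i v) j) * f (grid_step j (grid_step i v))) = 0.
  by apply: square_sum_sym => v i j /ca ->; rewrite grid_stepC.
under eq_square_sum do rewrite mulrDl.
by rewrite square_sumD addr_eq0 => /eqP ->; exact/eqP.
Qed.

(** Adding [coboundary f] to [a] and [coboundary g] to [b] does not change the sum, and afterwards
    one factor vanishes on every square. *)
Lemma cup_sum_eq0 a b f g : grid_cocycle a -> grid_cocycle b ->
  (forall v i j, grid_square v i j ->
     a v i = coboundary f v i \/
     b (grid_step i v) j = coboundary g (grid_step i v) j) ->
  cup_sum a b = 0.
Proof.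
move=> ca cb abfg; pose a' v i := a v i + coboundary f v i.
have ca' : grid_cocycle a' by exact/grid_cocycleD/coboundary_cocycle.
have -> : cup_sum a b = cup_sum a' b.
  rewrite /cup_sum /a'; under [RHS]eq_square_sum do rewrite mulrDl.
  rewrite square_sumD -!/(cup_sum _ _) [X in _ + X]cup_sum_coboundaryl//.
  by rewrite addr0.
transitivity (cup_sum a' (fun v i => b v i + coboundary g v i)).
  rewrite /cup_sum; under [RHS]eq_square_sum do rewrite mulrDr.
  rewrite square_sumD -!/(cup_sum _ _) [X in _ + X]cup_sum_coboundaryr//.
  by rewrite addr0.
rewrite /cup_sum /square_sum big1// => i _; rewrite big1// => j _.
rewrite big1// => v /abfg[] e; first by rewrite /a' e [X in X * _]addbb mul0r.
by rewrite e [X in _ * X]addbb mulr0.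
Qed.

End Grid.

(** * Holonomy of a local cocycle along paths *)

Section Cocycle.
Variables (R : realType) (Y : pseudoMetricType R) (c : Y -> Y -> bool) (e : R).

(** An Alexander-Spanier 1-cocycle mod 2: only values on pairs closer than [e] matter. It describes
    a double cover of [Y]. *)
Definition local_cocycle : Prop := forall x y z,
  ball x e y -> ball y e z -> ball x e z -> c x y + c y z = c x z.

Hypotheses (e0 : 0 < e) (cc : local_cocycle).

Lemma local_cocyclexx x : c x x = 0.
Proof.
have bx : ball x e x by exact: ballxx.
by have := cc bx bx bx; case: (c x x).
Qed.

Lemma local_cocycle_sum (g : nat -> Y) (m n : nat) : (m <= n)%N ->
  (forall i j, (m <= i <= n)%N -> (m <= j <= n)%N -> ball (g i) e (g j)) ->
  \sum_(m <= i < n) c (g i) (g i.+1) = c (g m) (g n).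
Proof.
elim: n => [|n IH].
  by rewrite leqn0 => /eqP -> _; rewrite big_geq// local_cocyclexx.
rewrite leq_eqVlt => /predU1P[-> _|]; first by rewrite big_geq// local_cocyclexx.
rewrite ltnS => mn gb; rewrite big_nat_recr//= IH//; last first.
  move=> i j /andP[mi im] /andP[mj jm].
  by apply: gb; rewrite ?mi ?mj (leq_trans _ (leqnSn n)).
by rewrite cc//; apply: gb; rewrite ?leqnn ?mn ?leqnSn ?(leq_trans mn).
Qed.

Definition holonomy (g : R -> Y) (n : nat) : bool :=
  \sum_(0 <= k < n) c (g (k%:R / n%:R)) (g (k.+1%:R / n%:R)).

Definition fine (g : R -> Y) (n : nat) : Prop := (0 < n)%N /\
  forall s t, 0 <= s <= 1 -> 0 <= t <= 1 -> `|s - t| <= n%:R^-1 ->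
  ball (g s) e (g t).

(** Fineness keeps all points of one subdivided step within [e] of each other, where the cocycle
    telescopes. Two fine subdivisions can then be compared through a common refinement. *)
Lemma holonomyM g n m : fine g n -> (0 < m)%N ->
  holonomy g (n * m) = holonomy g n.
Proof.
move=> [n0 gn] m0; rewrite /holonomy big_nat_mul; apply: eq_big_nat => k /andP[_ kn].
have nm0 : (0 : R) < (n * m)%:R by rewrite ltr0n muln_gt0 n0.
have nR0 : (0 : R) < n%:R by rewrite ltr0n.
have mR0 : (0 : R) < m%:R by rewrite ltr0n.
have E i : (i%:R : R) / n%:R = (i * m)%:R / (n * m)%:R.
  by rewrite !natrM; field; rewrite ?lt0r_neq0.
rewrite !E.
apply: (local_cocycle_sum (g := fun i => g (i%:R / (n * m)%:R))).
  by rewrite leq_mul2r leqnSn orbT.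
move=> i j /andP[ki ik] /andP[kj jk]; apply: gn.
- rewrite divr_ge0//= ler_pdivrMr// mul1r ler_nat (leq_trans ik)//.
  by rewrite leq_mul2r kn orbT.
- rewrite divr_ge0//= ler_pdivrMr// mul1r ler_nat (leq_trans jk)//.
  by rewrite leq_mul2r kn orbT.
- rewrite -mulrBl normrM [X in _ * X]gtr0_norm ?invr_gt0//.
  rewrite ler_pdivrMr// natrM mulKf ?lt0r_neq0//.
  rewrite ler_norml; move: ik jk; rewrite mulSn => ik jk.
  have: ((k * m)%:R : R) <= i%:R by rewrite ler_nat.
  have: ((k * m)%:R : R) <= j%:R by rewrite ler_nat.
  have: (i%:R : R) <= (m + k * m)%:R by rewrite ler_nat.
  have: (j%:R : R) <= (m + k * m)%:R by rewrite ler_nat.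
  by rewrite natrD; lra.
Qed.

Lemma holonomy_fine g n m : fine g n -> fine g m -> holonomy g n = holonomy g m.
Proof.
move=> gn gm; rewrite -(holonomyM gn gm.1) mulnC.
by rewrite (holonomyM gm gn.1).
Qed.

(** The rung between the two paths slides from time 0 to time 1, where it degenerates. Each cell of
    the ladder is cut by the diagonal from [g s] to [h t] into two triangles, to which the cocycle
    relation applies. *)
Lemma holonomy_ladder g h n : (0 < n)%N ->
  (forall s t, 0 <= s <= 1 -> 0 <= t <= 1 -> `|s - t| <= n%:R^-1 ->
     [/\ ball (g s) e (g t), ball (h s) e (h t) & ball (g s) e (h t)]) ->
  g 1 = h 1 -> c (g 0) (h 0) = holonomy g n + holonomy h n.
Proof.
move=> n0 gh gh1.
suff H k : (k <= n)%N -> c (g 0) (h 0) = c (g (k%:R / n%:R)) (h (k%:R / n%:R))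
   + (\sum_(0 <= i < k) c (g (i%:R / n%:R)) (g (i.+1%:R / n%:R))
   + \sum_(0 <= i < k) c (h (i%:R / n%:R)) (h (i.+1%:R / n%:R))).
  have nR0 : (n%:R : R) != 0 by rewrite pnatr_eq0 -lt0n.
  by rewrite (H n)// divff// gh1 local_cocyclexx add0r.
elim: k => [_|k IH kn]; first by rewrite !mul0r !big_geq// !addr0.
rewrite (IH (ltnW kn)) !big_nat_recr//=.
have nR0 : (0 : R) < n%:R by rewrite ltr0n.
have bnd i : (i <= n)%N -> 0 <= (i%:R : R) / n%:R <= 1.
  by move=> i_n; rewrite divr_ge0//= ler_pdivrMr// mul1r ler_nat.
set s := k%:R / n%:R; set t := k.+1%:R / n%:R.
have s01 : 0 <= s <= 1 by exact/bnd/ltnW.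
have t01 : 0 <= t <= 1 by exact: bnd.
have st : `|s - t| <= n%:R^-1.
  rewrite /s /t -mulrBl -natr1 opprD addNKr mulN1r normrN gtr0_norm ?invr_gt0//.
have ss : `|s - s| <= n%:R^-1 by rewrite subrr normr0 invr_ge0 ltW.
have tt : `|t - t| <= n%:R^-1 by rewrite subrr normr0 invr_ge0 ltW.
have [g1 h1 d1] := gh _ _ s01 t01 st.
have [_ _ d2] := gh _ _ s01 s01 ss.
have [_ _ d3] := gh _ _ t01 t01 tt.
have := cc d2 h1 d1; rewrite -(cc g1 d3 d1).
move: (c (g s) (g t)) (c (g t) (h t)) (c (g s) (h s)) (c (h s) (h t)).
move: (\sum_(_ <= _ < _) _) (\sum_(_ <= _ < _) _).
by do 6!case.
Qed.

End Cocycle.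

Definition primitive_near (R : realType) (Y : pseudoMetricType R)
    (c : Y -> Y -> bool) (f : Y -> bool) (x : Y) (d : R) : Prop :=
  forall y z, ball x d y -> ball x d z -> c y z = f y + f z.

(** A tube lemma: compactness of the time interval makes continuity along the track of [x] uniform
    in time. *)
Lemma homotopy_uniform (R : realType) (X : topologicalType)
    (Y : pseudoMetricType R) (H : X * R -> Y) (x : X) (e : R) : 0 < e ->
  {within [set: X] `*` `[0, 1], continuous H} ->
  \forall x' \near x & d \near 0^'+, forall s t : R, 0 <= s <= 1 ->
    0 <= t <= 1 -> `|s - t| <= d -> ball (H (x, s)) e (H (x', t)).
Proof.
move=> e0 /subspace_continuousP cH.
have /compact_near_coveringP/near_covering_withinP cpt := @segment_compact R 0 1.
have := cpt (X * R)%type (filter_prod (nbhs x) 0^'+) (fun p s =>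
  forall t, 0 <= t <= 1 -> `|s - t| <= p.2 -> ball (H (x, s)) e (H (p.1, t))).
move=> /(_ _ _)[].
  move=> s s01; have e2 : 0 < e / 2 by rewrite divr_gt0.
  have := cH (x, s) (conj I s01) _ (nbhsx_ballx _ _ e2).
  rewrite /within/= => -[[A B] [/= nA nB] AB].
  have /nbhs_ballP[d /= d0 dB] := nB.
  exists (ball s (d / 2), [set p : X * R | A p.1 /\ 0 < p.2 < d / 2]) => /=.
    split; first by apply: nbhsx_ballx; rewrite divr_gt0.
    exists (A, [set k | 0 < k < d / 2]) => //=; split=> //.
    by near=> k; apply/andP; split; near: k;
      [exact: nbhs_right_gt | apply: nbhs_right_lt; rewrite divr_gt0].
  move=> [s' [x' k]] /= [ss' [Ax' /andP[k0 kd]]] s'01 t t01 s't.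
  have d2 : d / 2 < d by rewrite ltr_pdivrMr// ltr_pMr// ltr1n.
  have [] := (AB (x, s'), AB (x', t)) => /= h1 h2.
  have /h1 b1 : A x /\ B s'.
    split; first exact: nbhs_singleton nA.
    by apply: dB; exact: le_ball (ltW d2) _ ss'.
  have /h2 b2 : A x' /\ B t.
    split=> //; apply: dB; rewrite (splitr d); apply: ball_triangle ss' _.
    by rewrite /ball/=; exact: le_lt_trans s't kd.
  rewrite (splitr e); apply: ball_triangle; first by apply/ball_sym/b1; split.
  by apply: b2; split.
move=> [A B] /= [nA nB] AB; exists (A, B) => //= -[x' d] [/= Ax' Bd] s t s01 t01.
by move/(AB (x', d)) => /=; apply.
Unshelve. all: by end_near. Qed.

(* Lifting the contraction of [U] to the double cover classified by [c] splits
   that cover over [U]. *)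
Lemma null_homotopic_primitive (R : realType) (Y : pseudoMetricType R)
    (c : Y -> Y -> bool) (e : R) (U : set Y) :
    0 < e -> local_cocycle c e -> open U -> null_homotopic_in R U ->
  exists f, forall x, U x -> \forall d \near 0^'+, primitive_near c f x d.
Proof.
move=> e0 cc oU [y0 [H [cH H0 H1]]]; pose g u t := H (u, t).
(* Half the radius, because [homotopy_uniform] compares a nearby track only with that of [u]; two
   nearby tracks are compared through it. *)
have e2 : 0 < e / 2 by rewrite divr_gt0.
have near_fine u : exists2 n, (0 < n)%N & \forall u' \near u,
    forall s t : R, 0 <= s <= 1 -> 0 <= t <= 1 -> `|s - t| <= n%:R^-1 ->
    ball (g u s) (e / 2) (g u' t).
  have [[A B] /= [nA nB] AB] := homotopy_uniform u e2 cH.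
  have [d /= d0 dB] := nB.
  have [n _ /(_ n (leqnn n)) nd] := near_infty_natSinv_lt (PosNum d0).
  exists n.+1 => //; near=> u' => s t s01 t01 st.
  apply: (AB (u', n.+1%:R^-1)) => //; split => /=; first exact: (near nA).
  by apply: dB => //=; rewrite sub0r normrN gtr0_norm.
have near_fine2 u n u1 u2 :
    (forall s t : R, 0 <= s <= 1 -> 0 <= t <= 1 -> `|s - t| <= n%:R^-1 ->
      ball (g u s) (e / 2) (g u1 t)) ->
    (forall s t : R, 0 <= s <= 1 -> 0 <= t <= 1 -> `|s - t| <= n%:R^-1 ->
      ball (g u s) (e / 2) (g u2 t)) ->
    forall s t : R, 0 <= s <= 1 -> 0 <= t <= 1 -> `|s - t| <= n%:R^-1 ->
      ball (g u1 s) e (g u2 t).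
  move=> b1 b2 s t s01 t01 st; rewrite (splitr e).
  apply: (ball_triangle (y := g u s)); last exact: b2.
  by apply/ball_sym/b1 => //; rewrite subrr normr0 invr_ge0.
have ex_fine u : exists n, fine e (g u) n.
  have [n n0 /nbhs_singleton un] := near_fine u.
  by exists n; split=> //; exact: (near_fine2 _ _ _ _ un un).
pose h u := holonomy c (g u) (projT1 (cid (ex_fine u))).
have hE u n : fine e (g u) n -> h u = holonomy c (g u) n.
  by rewrite /h; case: cid => m /= fm fn; exact: (holonomy_fine e0 cc).
(* The value [false] outside [U] is a dummy: the balls used below stay inside the open set [U]. *)
exists (fun y => if pselect (U y) is left Uy then h (exist _ y (mem_set Uy))
                 else false) => x Ux.
pose u : U := exist _ x (mem_set Ux).
(* One [n] serves all tracks starting near [x], as the ladder needs a common subdivision; [hE]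
   allows replacing the chosen subdivisions by it. *)
have [n n0 [B [[B' oB' BB'] Bu] nearB]] := near_fine u.
have /nbhs_ballP[d /= d0 dB] : nbhs x (U `&` B').
  apply: filterI; first exact: open_nbhs_nbhs.
  by apply: open_nbhs_nbhs; split=> //; move: Bu; rewrite -BB'.
near=> k => y z xky xkz.
have kd : k <= d by near: k; exact: nbhs_right_le.
have [Uy B'y] := dB _ (le_ball kd xky); have [Uz B'z] := dB _ (le_ball kd xkz).
case: pselect => // Uy'; case: pselect => // Uz'.
set u1 : U := exist _ y _; set u2 : U := exist _ z _.
have /nearB n1 : B u1 by rewrite -BB'.
have /nearB n2 : B u2 by rewrite -BB'.
rewrite (hE u1 n); last by split=> //; exact: (near_fine2 _ _ _ _ n1 n1).
rewrite (hE u2 n); last by split=> //; exact: (near_fine2 _ _ _ _ n2 n2).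
rewrite -(holonomy_ladder e0 cc n0) ?/g ?H0// ?H1//.
move=> s t s01 t01 st; split.
- exact: (near_fine2 _ _ _ _ n1 n1).
- exact: (near_fine2 _ _ _ _ n2 n2).
- exact: (near_fine2 _ _ _ _ n1 n2).
Unshelve. all: by end_near. Qed.

(** A Lebesgue number argument: primitives exist at a scale depending on the point, and compactness
    makes the scale uniform. *)
Lemma two_primitives (R : realType) (Y : pseudoMetricType R)
    (c d : Y -> Y -> bool) (e : R) (U V : set Y) :
    compact [set: Y] -> 0 < e -> local_cocycle c e -> local_cocycle d e ->
    open U -> open V -> null_homotopic_in R U -> null_homotopic_in R V ->
    U `|` V = setT ->
  exists f g, \forall k \near 0^'+, forall x,
    primitive_near c f x k \/ primitive_near d g x k.
Proof.
move=> cptY e0 cc cd oU oV hU hV UV.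
have [f Uf] := null_homotopic_primitive e0 cc oU hU.
have [g Vg] := null_homotopic_primitive e0 cd oV hV.
exists f, g; move/compact_near_coveringP : cptY => cptY.
suff nk : \forall k \near 0^'+, [set: Y] `<=` [set x |
    primitive_near c f x k \/ primitive_near d g x k].
  by near=> k => x; apply: (near nk k _ x I).
apply: (cptY R 0^'+ (fun k x =>
    primitive_near c f x k \/ primitive_near d g x k)).
(* A primitive at scale [k0] about [x] is one at every scale below [k0 / 2] about points within
   [k0 / 2] of [x]. *)
suff mono (b : Y -> Y -> bool) p x : (\forall k \near 0^'+, primitive_near b p x k) ->
    \forall x' \near x & k \near 0^'+, primitive_near b p x' k.
  move=> x _; have : (U `|` V) x by rewrite UV.
  case=> [/Uf/mono|/Vg/mono]; apply: filterS => q; [by left|by right].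
move=> nk; near (0 : R)^'+ => k0.
have k00 : 0 < k0 by near: k0; exact: nbhs_right_gt.
have pk0 : primitive_near b p x k0 by near: k0.
exists (ball x (k0 / 2), [set k | k < k0 / 2]) => /=.
  by split; [apply: nbhsx_ballx|apply: nbhs_right_lt]; rewrite divr_gt0.
move=> [x' k] /= [xx' kk0] y z x'y x'z.
by apply: pk0; rewrite (splitr k0); apply: ball_triangle xx' _;
  exact: le_ball (ltW kk0) _ _.
Unshelve. all: by end_near. Qed.

(** * The real moment angle complex and the lower bound *)

Section RealMomentAngle.
Variables (R : realType) (r : nat) (K : set {set 'I_r}).
Hypothesis Kdown : forall s t : {set 'I_r}, K s -> t \subset s -> K t.

Definition free_coords (x : 'rV[R]_r) : {set 'I_r} :=
  [set i | (-1 < x 0 i) && (x 0 i < 1)]%SET.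

(** [free_coords x] is the least simplex whose cell contains the point [x] of the cube, so for
    down-closed [K] it alone decides membership. *)
Lemma real_moment_angle_setP (x : 'rV[R]_r) :
  real_moment_angle_set R K x <->
  (forall i, -1 <= x 0 i <= 1) /\ K (free_coords x).
Proof.
split=> [[s /= sK [x1 xs]]|[x1 xK]].
  split=> //; apply: Kdown sK _; apply/fintype.subsetP => i; rewrite inE.
  by apply: contraLR => /xs[]->; rewrite !ltxx ?andbF.
exists (free_coords x) => //; split=> // i; rewrite inE.
by have := x1 i; rewrite !le_eqVlt; do 2!(case: eqVneq => [<-|_]; [by auto|]);
  move=> /=; case: (_ < _); case: (_ < _); auto.
Qed.

Lemma real_moment_angle_compact : compact (real_moment_angle_set R K).
Proof.
rewrite /real_moment_angle_set.
rewrite (_ : K = [set` (fun s => s \in K)]); last first.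
  by apply/seteqP; split=> s; rewrite /= inE.
rewrite bigcup_pred; apply: bigsetU_compact => s _.
pose D i := if i \in s then `[-1, 1]%classic else [set -1] `|` [set 1] : set R.
have -> : disk_sphere_power R s = [set x : 'rV[R]_r | forall i, D i (x ord0 i)].
  apply/seteqP; split=> [x [x1 xs] i|x xD].
    rewrite /D; case: ifPn => [_|/xs]; last by [].
    by rewrite /= in_itv /=; exact: x1.
  split=> i; have := xD i; rewrite /D; last by move=> /[swap] /negbTE ->.
  by case: ifP => _ /=; [rewrite in_itv|case=> ->; rewrite lexx ?andbT ?lerN10; lra].
apply: rV_compact => i; rewrite /D; case: ifP => _; first exact: segment_compact.
by apply: compactU; exact: compact_set1.
Qed.

Lemma minus_one_in : K !=set0 -> real_moment_angle_set R K (const_mx (-1)).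
Proof.
move=> [s Ks]; apply/real_moment_angle_setP; split=> [i|].
  by rewrite mxE lexx; lra.
by apply: Kdown Ks _; apply/fintype.subsetP => i; rewrite !inE mxE ltxx.
Qed.

End RealMomentAngle.

Lemma compact_set_type (X : topologicalType) (A : set X) :
  compact A -> compact [set: A].
Proof.
move=> /compact_near_coveringP cA; apply/compact_near_coveringP => J F P FF FP.
suff : \forall i \near F, A `<=` [set x | forall h, P i (exist _ x h)].
  apply: filterS => i AP [x xA] _; apply: (AP x); exact: set_mem.
apply: (cA J F (fun i x => forall h, P i (exist _ x h))) => x Ax.
have [[B G] /= [[_ [[W oW <-]] Wx WB] FG] BG] := FP (exist _ x (mem_set Ax)) I.
exists (W, G) => /=; first by split=> //; exact: open_nbhs_nbhs.
move=> [x' i] /= [Wx' Gi] h; apply: (BG (exist _ x' h, i)).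
by split=> //; exact: WB.
Qed.

Definition adjacent (r : nat) (K : set {set 'I_r}) (i j : 'I_r) : bool :=
  (i != j) && ([set i; j]%SET \in K).

Lemma adjacent_sym (r : nat) (K : set {set 'I_r}) : symmetric (adjacent K).
Proof. by move=> i j; rewrite /adjacent eq_sym finset.setUC. Qed.

Lemma adjacent_irr (r : nat) (K : set {set 'I_r}) : irreflexive (adjacent K).
Proof. by move=> i; rewrite /adjacent eqxx. Qed.

Section LowerBound.
Variables (R : realType) (r : nat) (K : set {set 'I_r}).
Hypothesis Kdown : forall s t : {set 'I_r}, K s -> t \subset s -> K t.
Hypothesis Keven : forall j, ~~ odd #|[pred i | adjacent K i j]|.
Variables (p q : 'I_r).
Hypotheses (pq : adjacent K p q).
Hypothesis Ktri : forall k, ~~ (adjacent K p k && adjacent K q k).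

Local Notation E := (adjacent K).
Local Notation Y := (set_type (real_moment_angle_set R K)).

(** At a point of the complex with [x 0 p] strictly between -1 and 1, the coordinates not adjacent
    to [p] are -1 or 1, so negative means -1 there. *)
Definition other_negative (p : 'I_r) (x : 'rV[R]_r) : bool :=
  [forall j, (j != p) ==> ~~ E p j ==> (x 0 j < 0)].

(* Intersection number mod 2 with the circle [x_p = 0], [x_j = -1] for [j] not
   adjacent to [p]. *)
Definition crossing (p : 'I_r) (x y : Y) : bool :=
  ((0 < val x 0 p) (+) (0 < val y 0 p)) && other_negative p (val x).

Lemma ball_coord (x y : Y) (e : R) : ball x e y <->
  0 < e /\ forall i, `|val x 0 i - val y 0 i| < e.
Proof.
split=> [[e0 xy]|[e0 xy]]; first by split=> // i; have := xy 0 i.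
by split=> // i j; rewrite ord1; exact: xy.
Qed.

Lemma set_typeP (x : Y) : (forall i, -1 <= val x 0 i <= 1) /\
  K (free_coords (val x)).
Proof. by apply/real_moment_angle_setP => //; exact: set_mem (valP x). Qed.

(** When coordinate [i] changes sign over so short a distance, it is strictly inside (-1, 1) at both
    points. The coordinates not adjacent to [i] are then -1 or 1 at both, and too close to
    differ. *)
Lemma other_negative_eq i (x y : Y) : ball x (1 / 2) y ->
  (0 < val x 0 i) != (0 < val y 0 i) ->
  other_negative i (val x) = other_negative i (val y).
Proof.
move=> /ball_coord[_ xy] sxy.
have [x1 xK] := set_typeP x; have [y1 yK] := set_typeP y.
have [xi yi] : (-1 < val x 0 i < 1) /\ (-1 < val y 0 i < 1).
  move: sxy (xy i); rewrite ltr_norml.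
  by case: ltP => ? /=; case: ltP => //= ? _ /andP[? ?];
    split; apply/andP; split; lra.
apply: eq_forallb => j; have [//|/= ji] := eqVneq j i.
have [//|/= nij] := boolP (E i j).
have ext (z : Y) : -1 < val z 0 i < 1 -> val z 0 j = -1 \/ val z 0 j = 1.
  move=> zi; have [z1 zK] := set_typeP z.
  have : ~~ (-1 < val z 0 j < 1).
    apply: contra nij => zj; rewrite /adjacent eq_sym ji/=; apply/mem_set.
    apply: Kdown zK _; apply/fintype.subsetP => k.
    by rewrite !inE => /orP[] /eqP ->.
  have := z1 j; rewrite !le_eqVlt.
  by do 2!(case: eqVneq => [<-|_]; [by auto|]); move=> /= ->.
have := xy j; have [->|->] := ext x xi; have [->|->] := ext y yi => //.
  by rewrite ltr_norml => /andP[? ?]; exfalso; lra.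
by rewrite ltr_norml => /andP[? ?]; exfalso; lra.
Qed.

Lemma crossing_cocycle i : local_cocycle (crossing i) (1 / 2).
Proof.
move=> x y z xy yz xz; rewrite /crossing.
move: (@other_negative_eq i _ _ xy) (@other_negative_eq i _ _ yz).
move: (@other_negative_eq i _ _ xz).
move: (other_negative i (val x)) (other_negative i (val y)) => px py.
move: (other_negative i (val z)) => pz.
move: (0 < val x 0 i) (0 < val y 0 i) (0 < val z 0 i) => sx sy sz.
by case: sx sy sz => [] [] [] //=; case: px py pz => [] [] [] //= h1 h2 h3;
  do ?[by have := h1 isT | by have := h2 isT | by have := h3 isT].
Qed.

(** * Sampling the complex on a grid *)

Section GridPoints.
Variable (m : nat).
Local Notation N := m.*2.+1.
Local Notation grid := {ffun 'I_r -> 'I_N.+1}.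
Local Notation square := (@grid_square r N E).

(** As [N] is odd, no grid coordinate is 0, and signs change only on the middle interval from [m] to
    [m.+1]. *)
Definition grid_point (v : grid) : 'rV[R]_r :=
  \row_i (-1 + 2 * (v i)%:R / N%:R).

Let N0 : (0 : R) < N%:R. Proof. by rewrite ltr0n. Qed.
Let NE : (N%:R : R) = 2 * m%:R + 1.
Proof. by rewrite -addn1 natrD -mul2n natrM. Qed.

Lemma grid_point_gt0 v i : (0 < grid_point v 0 i) = (m < v i)%N.
Proof.
rewrite mxE addrC subr_gt0 ltr_pdivlMr// mul1r NE.
apply/idP/idP => [|mv].
  by apply: contraTT; rewrite -leqNgt -leNgt -(ler_nat R) => ?; lra.
by have : (m.+1%:R : R) <= (v i)%:R; [rewrite ler_nat|rewrite -natr1; lra].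
Qed.

Lemma grid_point_lt0 v i : (grid_point v 0 i < 0) = (v i <= m)%N.
Proof.
rewrite mxE addrC subr_lt0 ltr_pdivrMr// mul1r NE.
apply/idP/idP => [|mv].
  apply: contraTT; rewrite -leNgt -ltnNge -(ler_nat R) -natr1 => ?; lra.
by have : ((v i)%:R : R) <= m%:R; [rewrite ler_nat|lra].
Qed.

Lemma grid_pointP v : (forall i, -1 <= grid_point v 0 i <= 1) /\
  free_coords (grid_point v) = [set i | ~~ grid_extreme (v i)]%SET.
Proof.
have le1 i : 0 <= ((v i)%:R : R) / N%:R <= 1.
  by rewrite divr_ge0//= ler_pdivrMr// mul1r ler_nat -ltnS ltn_ord.
split=> [i|].
  rewrite mxE -mulrA; have := le1 i; move: (_ / _) => t /andP[? ?].
  by apply/andP; split; lra.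
apply/setP => i; rewrite !inE mxE /grid_extreme negb_or -mulrA.
have E0 : (v i != 0 :> nat) = (0 < (v i)%:R / N%:R :> R).
  by rewrite -lt0n -(ltr0n R) pmulr_lgt0// invr_gt0.
have E1 : (v i != N :> nat) = ((v i)%:R / N%:R < 1 :> R).
  rewrite ltr_pdivrMr// mul1r ltr_nat ltn_neqAle.
  by rewrite -[(v i <= N)%N]ltnS ltn_ord andbT.
rewrite {}E0 {}E1; move: (_ / _) => t.
by apply/andP/andP => -[? ?]; split; lra.
Qed.

Let K0 : K !=set0. Proof. by exists [set p; q]%SET; case/andP: pq => _ /set_mem. Qed.

(** Grid points outside the complex go to the vertex with all coordinates -1; by [grid_lift_val]
    this default is never met at a corner of a square. *)
Definition grid_lift (v : grid) : Y :=
  insubd (exist (fun x => x \in real_moment_angle_set R K) _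
    (mem_set (minus_one_in R Kdown K0)) : Y) (grid_point v).

Definition corner (v : grid) (i j : 'I_r) (w : grid) : Prop := forall k,
  if (k == i) || (k == j) then (v k <= w k <= (v k).+1)%N else w k == v k.

Lemma grid_lift_val v i j w : square v i j -> corner v i j w ->
  val (grid_lift w) = grid_point w.
Proof.
move=> /and4P[/andP[_ /set_mem Eij] _ _ /forallP ext] cw.
rewrite val_insubd ifT//; apply/mem_set/real_moment_angle_setP => //.
have [? ->] := grid_pointP w; split=> //; apply: Kdown Eij _.
apply/fintype.subsetP => k; rewrite !inE; apply: contraR.
have := cw k; have := ext k.
by case: (k == i) => //=; case: (k == j) => //= ? /eqP ->.
Qed.

Lemma grid_lift_ball v i j w w' e : square v i j -> corner v i j w ->
  corner v i j w' -> 2 / N%:R < e -> ball (grid_lift w) e (grid_lift w').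
Proof.
move=> sq cw cw' eN; apply/ball_coord; split.
  by apply: lt_trans eN; rewrite divr_gt0.
move=> k; rewrite (grid_lift_val sq cw) (grid_lift_val sq cw') !mxE.
have : ((w k <= (w' k).+1) && (w' k <= (w k).+1))%N.
  by have := cw k; have := cw' k; case: ifP => _; [lia|move=> /eqP -> /eqP ->; lia].
rewrite -!(ler_nat R) -![_.+1%:R in X in X -> _]natr1 => /andP[ww w'w].
apply: le_lt_trans eN; set a := ((w k)%:R : R) in ww w'w *.
set b := ((w' k)%:R : R) in ww w'w *.
have -> : -1 + 2 * a / N%:R - (-1 + 2 * b / N%:R) = (a - b) * (2 / N%:R).
  by move: N%:R^-1 => t; ring.
rewrite normrM [X in _ * X]gtr0_norm ?divr_gt0// ler_piMl ?divr_ge0//.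
by rewrite ler_norml; apply/andP; split; lra.
Qed.

Lemma grid_step_val (v : grid) i k : (v i < N)%N ->
  grid_step i v k = (v k + (k == i))%N :> nat.
Proof.
move=> vi; rewrite grid_stepE; case: eqP => [->|_]; last by rewrite addn0.
by rewrite /= modn_small// addn1.
Qed.

Lemma corners v i j : square v i j ->
  [/\ corner v i j v, corner v i j (grid_step i v), corner v i j (grid_step j v)
    & corner v i j (grid_step j (grid_step i v))].
Proof.
move=> /and4P[Eij vi vj _].
have ij : i != j by case/andP: Eij.
have Eji : (j == i) = false by rewrite eq_sym (negbTE ij).
have ki_kj k : ~~ ((k == i) && (k == j)).
  by apply: contra ij => /andP[/eqP <- /eqP ->].
split=> k; have := ki_kj k; case Eki: (k == i); case Ekj: (k == j) => //= _;
  do ?[by rewrite !grid_stepE ?Eki ?Ekj];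
  rewrite ?grid_step_val ?Eki ?Ekj ?Eji ?addn0 //; lia.
Qed.

Definition grid_crossing (i : 'I_r) (v : grid) (k : 'I_r) : bool :=
  crossing i (grid_lift v) (grid_lift (grid_step k v)).

Lemma grid_crossing_cocycle i : 2 / N%:R < 1 / 2 :> R ->
  grid_cocycle E (grid_crossing i).
Proof.
move=> N2 v j k sq; have [c1 c2 c3 c4] := corners sq.
have gb w w' : corner v j k w -> corner v j k w' ->
    ball (grid_lift w) (1 / 2) (grid_lift w').
  by move=> cw cw'; exact: grid_lift_ball sq cw cw' N2.
rewrite /grid_crossing (grid_stepC j k).
have cr w w' w'' := @crossing_cocycle i (grid_lift w) (grid_lift w') (grid_lift w'').
rewrite (cr _ _ _ (gb _ _ c1 c2) (gb _ _ c2 c4) (gb _ _ c1 c4)).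
by rewrite (cr _ _ _ (gb _ _ c1 c3) (gb _ _ c3 c4) (gb _ _ c1 c4)).
Qed.

Lemma grid_crossingE i (v : grid) l :
    val (grid_lift v) = grid_point v ->
    val (grid_lift (grid_step l v)) = grid_point (grid_step l v) ->
    (v l < N)%N -> (forall k, k != l -> ~~ E l k -> grid_extreme (v k)) ->
  grid_crossing i v l = [&& l == i, v l == m :> nat &
    [forall k, (k != i) ==> ~~ E i k ==> (v k == 0 :> nat)]].
Proof.
move=> v1 v2 vl ext; rewrite /grid_crossing /crossing v1 v2 !grid_point_gt0.
rewrite grid_step_val// [i == l]eq_sym; have [li|nli] := eqVneq l i; last first.
  by rewrite addn0 addbb.
rewrite -li (_ : (_ (+) _) = (v l == m :> nat)); last by rewrite /=; lia.
rewrite /=; case: eqP => //= vlm; apply: eq_forallb => k.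
have [//|/= kl] := eqVneq k l; have [//|/= nlk] := boolP (E l k).
by rewrite grid_point_lt0; case/orP: (ext k kl nlk) => /eqP ->; lia.
Qed.

Lemma cup_crossing : (0 < m)%N ->
  cup_sum E (grid_crossing p) (grid_crossing q) = true.
Proof.
move=> m0; have npq : p != q by case/andP: pq.
(* The square around the intersection point: middle interval in directions [p] and [q], all other
   coordinates -1. *)
pose v0 : grid := [ffun k => if (k == p) || (k == q) then inord m else ord0].
have m_lt : (m < N.+1)%N by lia.
have v0p : v0 p = m :> nat by rewrite ffunE eqxx inordK.
have v0q : v0 q = m :> nat by rewrite ffunE eqxx orbT inordK.
have v0k k : k != p -> k != q -> v0 k = 0 :> nat.
  by move=> kp kq; rewrite ffunE (negbTE kp) (negbTE kq).
have sq0 : square v0 p q.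
  rewrite /grid_square pq v0p v0q; apply/and4P; split=> //; try lia.
  apply/forallP => k; apply/implyP => kp; apply/implyP => kq.
  by rewrite /grid_extreme v0k.
have summand v i j : square v i j ->
    grid_crossing p v i * grid_crossing q (grid_step i v) j =
    [&& i == p, j == q & v == v0].
  move=> sq; have [c1 c2 c3 c4] := corners sq.
  have lv := grid_lift_val sq; have [Eij vi vj /forallP ext] := and4P sq.
  have nij : i != j by case/andP: Eij.
  have svj : grid_step i v j = v j.
    by rewrite grid_stepE eq_sym (negbTE nij).
  rewrite !grid_crossingE ?lv// ?svj//.
  - apply/idP/idP => [|/and3P[/eqP -> /eqP -> /eqP ->]].
      move=> /andP[/and3P[/eqP ip /eqP vim /forallP v0i]].
      move=> /and3P[/eqP jq /eqP vjm /forallP v0j]; subst i j.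
      rewrite !eqxx; apply/eqP/ffunP => k; apply: val_inj => /=.
      have [->|kp] := eqVneq k p; first by rewrite v0p.
      have [->|kq] := eqVneq k q; first by rewrite v0q.
      (* Since [k] is not adjacent to both [p] and [q], one of the two crossings forces its index to
         be 0. *)
      rewrite v0k//; apply/eqP; have := Ktri k; rewrite negb_and => /orP[nk|nk].
        by have := v0i k; rewrite kp nk.
      by have := v0j k; rewrite kq nk grid_stepE (negbTE kp).
    rewrite !eqxx v0p v0q eqxx /=; apply/andP; split; apply/forallP => k;
      apply/implyP => kp; apply/implyP => nk; apply/eqP.
      by apply: v0k => //; apply: contraNneq nk => ->.
    have kp' : k != p by apply: contraNneq nk => ->; rewrite adjacent_sym.
    by rewrite grid_stepE (negbTE kp') v0k.
  - move=> k kj nk; have ki : k != i.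
      by apply: contraNneq nk => ->; rewrite adjacent_sym.
    by rewrite grid_stepE (negbTE ki); have := ext k; rewrite ki kj.
  - move=> k ki nk; have := ext k; rewrite ki /=; move/implyP; apply.
    by apply: contraNneq nk => ->.
(* Counting squares in both orders does not cancel this term: only the order [(p, q)]
   contributes. *)
rewrite /cup_sum (eq_square_sum summand) /square_sum.
rewrite (bigD1 p)//= (bigD1 q)//= (bigD1 v0)//= !eqxx !big1 ?addr0// => [i|j|v].
- by move=> /negbTE ip; rewrite big1// => j _; rewrite big1// => v _; rewrite ip.
- by move=> /andP[_ /negbTE jq]; rewrite big1// => v _; rewrite jq.
- by move=> /andP[_ /negbTE ->].
Qed.

End GridPoints.

Lemma no_two_set_cover (U V : set Y) : open U -> open V ->
  null_homotopic_in R U -> null_homotopic_in R V -> U `|` V <> setT.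
Proof.
move=> oU oV hU hV UV.
have cptY : compact [set: Y].
  exact/compact_set_type/real_moment_angle_compact.
have half0 : 0 < 1 / 2 :> R by [].
have [f [g fg]] := two_primitives cptY half0 (@crossing_cocycle p)
  (@crossing_cocycle q) oU oV hU hV UV.
near (0 : R)^'+ => k.
have k0 : 0 < k by near: k; exact: nbhs_right_gt.
have k2 : k < 1 / 2 by near: k; exact: nbhs_right_lt.
have fgk x : primitive_near (crossing p) f x k \/ primitive_near (crossing q) g x k.
  by move: x; near: k.
have [n _ /(_ n (leqnn n)) /= nk] := near_infty_natSinv_lt (PosNum k0).
have Nk : 2 / n.+1.*2.+1%:R < k.
  apply: lt_trans nk; rewrite -[ltRHS]mul1r ltr_pdivrMr ?ltr0n//.
  rewrite mulrAC ltr_pdivlMr ?ltr0n// mul1r -natrM ltr_nat; lia.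
have := cup_crossing (ltn0Sn n); rewrite (_ : cup_sum _ _ _ = 0)//.
apply: (@cup_sum_eq0 _ _ _ _ _ _ _ _ _
  (f \o @grid_lift n.+1) (g \o @grid_lift n.+1)) => //.
- exact: adjacent_sym.
- exact: adjacent_irr.
- exact/grid_crossing_cocycle/(lt_trans Nk).
- exact/grid_crossing_cocycle/(lt_trans Nk).
move=> v i j sq; have [c1 c2 c3 c4] := corners sq.
have near w w' := grid_lift_ball (w := w) (w' := w') sq.
(* The ball is centred at the vertex shared by the front and back edges, so it contains both edges'
   end points. *)
have [pf|pg] := fgk (grid_lift (grid_step i v)).
  by left; apply: pf; exact: near.
by right; apply: pg; exact: near.
Unshelve. all: by end_near. Qed.

End LowerBound.

(** * The upper bound *)

Lemma within_continuous_set_type (X Z : topologicalType) (A : set Z) (D : set X)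
    (h : X -> A) :
  {within D, continuous (set_val \o h)} -> {within D, continuous h}.
Proof.
move=> /subspace_continuousP ch; apply/subspace_continuousP => x Dx.
move=> B [_ [[W oW <-]] Wx WB]; apply: filterS WB _.
by apply: (ch x Dx); exact: open_nbhs_nbhs.
Qed.

Lemma continuous_row (T : topologicalType) (R : realType) (n : nat)
    (h : T -> 'rV[R]_n) :
  (forall i, continuous (fun x => h x 0 i)) -> continuous h.
Proof.
move=> ch x B [P nP PB]; apply: filterS (fun y => PB (h y)) _.
apply: filter_forall => i; apply: filter_forall => j.
by rewrite (ord1 i); apply: ch; have := nP i j; rewrite (ord1 i).
Qed.

Section UpperBound.
Variables (R : realType) (r : nat) (K : set {set 'I_r}).
Hypothesis Kdown : forall s t : {set 'I_r}, K s -> t \subset s -> K t.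
Hypothesis K1 : forall i, K [set i]%SET.

Local Notation Y := (set_type (real_moment_angle_set R K)).

(** A ramp rising from 0 to 1 while [s] runs from [k] to [k + 1]; such ramps schedule the [r.+1]
    stages of [track]. *)
Definition clamp (k : nat) (s : R) : R := Num.max 0 (Num.min 1 (s - k%:R)).

Lemma clamp_ge0_le1 k s : 0 <= clamp k s <= 1.
Proof. by rewrite /clamp le_max lexx ge_max ler01 ge_min lexx. Qed.

Lemma clamp0 k s : s <= k%:R -> clamp k s = 0.
Proof.
move=> sk; apply/max_idPl; rewrite ge_min subr_le0 sk orbT //.
Qed.

Lemma clamp1 k s : k.+1%:R <= s -> clamp k s = 1.
Proof.
rewrite -natr1 => ks; rewrite /clamp min_l; first by rewrite max_r.
by rewrite lerBrDl.
Qed.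

Lemma clamp_continuous k : continuous (clamp k).
Proof.
move=> s; apply: (@continuous_max R R (cst 0) (fun s => Num.min 1 (s - k%:R))).
  exact: cvg_cst.
apply: (@continuous_min R R (cst 1) (fun s => s - k%:R)); first exact: cvg_cst.
by apply: cvgB; [exact: cvg_id|exact: cvg_cst].
Qed.

(* First the straight line from [x] to the vertex [g]; then each coordinate in
   turn is moved to [-1]. *)
Definition track (x g : 'rV[R]_r) (t : R) : 'rV[R]_r :=
  let s := t * r.+1%:R in
  \row_i ((1 - clamp i.+1 s) * ((1 - clamp 0 s) * x 0 i + clamp 0 s * g 0 i)
          + clamp i.+1 s * (-1)).

Lemma track0 x g : track x g 0 = x.
Proof.
apply/rowP => i; rewrite mxE mul0r !clamp0 ?ler0n//.
by rewrite subr0 !mul1r !mul0r !addr0.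
Qed.

Lemma track1 x g : track x g 1 = const_mx (-1).
Proof.
apply/rowP => i; rewrite !mxE mul1r (clamp1 (k := i.+1)).
  by rewrite subrr mul0r add0r mul1r.
by rewrite ler_nat ltnS.
Qed.

Lemma convex_le1 (b x y : R) : 0 <= b <= 1 -> -1 <= x <= 1 -> -1 <= y <= 1 ->
  -1 <= (1 - b) * x + b * y <= 1.
Proof.
by move=> /andP[? ?] /andP[? ?] /andP[? ?]; apply/andP; split; nra.
Qed.

(** In the first stage coordinates at -1 or 1 stay put, so no new coordinate becomes free. Later at
    most the coordinate being moved is free, and its singleton is in [K]. *)
Lemma track_in (x g : 'rV[R]_r) (t : R) : real_moment_angle_set R K x ->
  (forall i, g 0 i = -1 \/ g 0 i = 1) ->
  (forall i, x 0 i = -1 \/ x 0 i = 1 -> g 0 i = x 0 i) ->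
  real_moment_angle_set R K (track x g t).
Proof.
move=> /(real_moment_angle_setP Kdown)[x1 xK] g1 gx.
apply/(real_moment_angle_setP Kdown); split=> [i|].
  have c01 k := clamp_ge0_le1 k (t * r.+1%:R).
  rewrite mxE; apply: (convex_le1 (c01 i.+1)); last by rewrite lexx; lra.
  by apply: (convex_le1 (c01 0)) => //; have [->|->] := g1 i; lra.
set s := t * r.+1%:R; have [s1|s1] := lerP s 1.
  apply: (Kdown xK); apply/fintype.subsetP => i; rewrite !inE mxE -/s.
  rewrite (clamp0 (k := i.+1)); last by rewrite (le_trans s1)// ler1n.
  rewrite mul0r addr0 subr0 mul1r; apply: contraLR => nx.
  have xi : x 0 i = -1 \/ x 0 i = 1.
    have := x1 i; move: nx; rewrite !le_eqVlt.
    by do 2!(case: eqVneq => [<-|_]; [by auto|]); move=> /= /negbTE ->.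
  rewrite gx// -mulrDl subrK mul1r; by case: xi => ->; rewrite !ltxx ?andbF.
have freeE i : i \in free_coords (track x g t) -> i.+1%:R < s < i.+2%:R.
  rewrite !inE mxE -/s (clamp1 (k := 0) (ltW s1)) subrr mul0r add0r mul1r.
  apply: contraLR; rewrite negb_and -!leNgt => /orP[/clamp0|/clamp1] ->.
    by rewrite subr0 mul0r mul1r addr0; case: (g1 i) => ->; rewrite !ltxx ?andbF.
  by rewrite subrr mul0r add0r mul1r !ltxx.
case: (set_0Vmem (free_coords (track x g t))) => [->|[i fi]].
  by apply: (Kdown xK); exact: finset.sub0set.
apply: (Kdown (K1 i)); apply/fintype.subsetP => j fj; rewrite inE.
have /andP[i1 i2] := freeE i fi; have /andP[j1 j2] := freeE j fj.
have := lt_trans i1 j2; have := lt_trans j1 i2; rewrite !ltr_nat => ij ji.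
by apply/eqP/val_inj => /=; lia.
Qed.

(** Local constancy of [g] makes the tracks continuous in the starting point; all of them end at the
    same vertex, so one homotopy contracts every piece of [U]. *)
Lemma null_homotopic_to_vertices (U : set Y) (g : U -> 'rV[R]_r) :
  K !=set0 ->
  (forall u : U, \forall u' \near u, g u' = g u) ->
  (forall (u : U) i, g u 0 i = -1 \/ g u 0 i = 1) ->
  (forall (u : U) i, val (val u) 0 i = -1 \/ val (val u) 0 i = 1 ->
     g u 0 i = val (val u) 0 i) ->
  null_homotopic_in R U.
Proof.
move=> K0 g_near g1 gx.
have inY (u : U) t : track (val (val u)) (g u) t \in real_moment_angle_set R K.
  apply/mem_set/track_in => //; last exact: gx.
  by case: (val u) => x xA; exact: set_mem xA.
pose H (p : U * R) : Y := exist (fun x => x \in real_moment_angle_set R K) _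
  (inY p.1 p.2).
exists (exist (fun x => x \in real_moment_angle_set R K) _
  (mem_set (minus_one_in R Kdown K0))), H; split; last 2 first.
- by move=> u; apply: val_inj; rewrite /= track0.
- by move=> u; apply: val_inj; rewrite /= track1.
apply: (@continuous_subspaceW _ _ _ [set: U * R]) => //.
apply/within_continuous_set_type/continuous_subspaceT.
apply: continuous_row => i p /=.
have fstc : p'.1 @[p' --> p] --> p.1 by exact: cvg_fst.
have -> : (fun p' : U * R => (set_val (H p')) 0 i) = (fun p' =>
   (1 - clamp i.+1 (p'.2 * r.+1%:R)) *
   ((1 - clamp 0 (p'.2 * r.+1%:R)) * val (val p'.1) 0 i +
    clamp 0 (p'.2 * r.+1%:R) * g p'.1 0 i) + clamp i.+1 (p'.2 * r.+1%:R) * (-1)).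
  by apply/funext => p'; rewrite /= mxE.
have cs : (p'.2 * r.+1%:R : R) @[p' --> p] --> p.2 * r.+1%:R.
  by apply: (@cvgM R _ (nbhs p) _ snd (cst r.+1%:R)); [exact: cvg_snd|exact: cvg_cst].
have cl k : clamp k (p'.2 * r.+1%:R) @[p' --> p] --> clamp k (p.2 * r.+1%:R).
  by apply: (continuous_cvg _ _ cs); exact: clamp_continuous.
have cx : (fun p' : U * R => val (val p'.1) 0 i) @ p --> val (val p.1) 0 i.
  have c1 : (fun p' : U * R => set_val p'.1 : Y) @ p --> (set_val p.1 : Y).
    by apply: (continuous_cvg _ _ fstc); exact: initial_continuous.
  have c2 : (fun p' : U * R => set_val (set_val p'.1 : Y) : 'rV[R]_r) @ p -->
      (set_val (set_val p.1 : Y) : 'rV[R]_r).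
    by apply: (continuous_cvg _ _ c1); exact: initial_continuous.
  exact: (continuous_cvg _ (@coord_continuous R 1 r 0 i _) c2).
have cg : (fun p' : U * R => g p'.1 0 i) @ p --> g p.1 0 i.
  apply: cvg_near_cst.
  apply: (@filterS _ (nbhs p) _ (fun p' : U * R => g p'.1 = g p.1)).
    by move=> p' /= ->.
  exact: fstc _ (g_near p.1).
apply: cvgD; last by apply: cvgM; [exact: cl|exact: cvg_cst].
apply: cvgM; first by apply: cvgB; [exact: cvg_cst|exact: cl].
apply: cvgD; apply: cvgM => //.
by apply: cvgB; [exact: cvg_cst|exact: cl].
Qed.

Hypothesis K2 : forall s, K s -> (#|s| <= 2)%N.
Hypothesis r_gt2 : (2 < r)%N.

(** For empty [s] the first clause is vacuous, and the second still makes the signs taken by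
    [vertex] nonzero. *)
Definition separates (s : {set 'I_r}) (x : 'rV[R]_r) : bool :=
  [forall i, (i \in s) ==> [forall j, (j \notin s) ==> (`|x 0 i| < `|x 0 j|)]]
  && [forall j, (j \notin s) ==> (x 0 j != 0)].

Lemma separatesP (s : {set 'I_r}) (x : 'rV[R]_r) : reflect
  ((forall i j, i \in s -> j \notin s -> `|x 0 i| < `|x 0 j|) /\
   (forall j, j \notin s -> x 0 j != 0)) (separates s x).
Proof.
apply: (iffP andP) => -[h1 h2]; split.
- by move=> i j si sj; move/forallP/(_ i)/implyP/(_ si)/forallP/(_ j)/implyP : h1; exact.
- by move=> j sj; move/forallP/(_ j)/implyP : h2; exact.
- apply/forallP => i; apply/implyP => si; apply/forallP => j; apply/implyP.
  exact: h1.
- by apply/forallP => j; apply/implyP; exact: h2.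
Qed.

(** Otherwise some [i] in [s] outside [t] and some [j] in [t] outside [s] would each be smaller than
    the other. Hence a stratum is a disjoint union of open pieces, one for each [s]. *)
Lemma separates_inj (s t : {set 'I_r}) (x : 'rV[R]_r) :
  #|s| = #|t| -> separates s x -> separates t x -> s = t.
Proof.
move=> st /separatesP[sx _] /separatesP[tx _]; apply/eqP.
rewrite eqEcard -st leqnn andbT; apply/negPn/negP => nst.
have /subsetPn[i si ti] := nst.
have : ~~ (t \subset s).
  by apply: contra nst => ts; have /eqP <- : t == s by rewrite eqEcard ts st leqnn.
move=> /subsetPn[j tj sj].
by have := lt_trans (sx i j si sj) (tx j i tj ti); rewrite ltxx.
Qed.

Definition vertex (s : {set 'I_r}) (x : 'rV[R]_r) : 'rV[R]_r :=
  \row_j if j \in s then -1 else Num.sg (x 0 j).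

Lemma coord_cvg (x : Y) i : (fun x' : Y => val x' 0 i) @ x --> val x 0 i.
Proof.
have c1 : (fun x' : Y => val x') @ x --> val x by exact: initial_continuous.
exact: (continuous_cvg _ (@coord_continuous R 1 r 0 i _) c1).
Qed.

Lemma separates_near (s : {set 'I_r}) (x : Y) : separates s (val x) ->
  \forall x' \near x, separates s (val (x' : Y)) /\
    vertex s (val (x' : Y)) = vertex s (val x).
Proof.
move=> /separatesP[sx s0].
have n1 : \forall x' \near x, forall i j, i \in s -> j \notin s ->
    `|val (x' : Y) 0 i| < `|val (x' : Y) 0 j|.
  apply: (@filter_forall _ 'I_r _ _ (nbhs_filter x)) => i.
  apply: (@filter_forall _ 'I_r _ _ (nbhs_filter x)) => j.
  have [si|nsi] := boolP (i \in s); last by near=> x'.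
  have [sj|nsj] := boolP (j \in s); first by near=> x'.
  have [m /andP[im mj]] : exists m : R, `|val x 0 i| < m < `|val x 0 j|.
    by exists ((`|val x 0 i| + `|val x 0 j|) / 2); have := sx i j si nsj; lra.
  have /cvgr_norm_lt/(_ _ im) ni := @coord_cvg x i.
  have /cvgr_norm_gt/(_ _ mj) nj := @coord_cvg x j.
  near=> x' => _ _; apply: (@lt_trans _ _ m); first by near: x'.
  by near: x'.
have n2 : \forall x' \near x, forall j, j \notin s ->
    val (x' : Y) 0 j != 0 /\ Num.sg (val (x' : Y) 0 j) = Num.sg (val x 0 j).
  apply: (@filter_forall _ 'I_r _ _ (nbhs_filter x)) => j.
  have [sj|nsj] := boolP (j \in s); first by near=> x'.
  have [lt0|gt0|eq0] := ltgtP (val x 0 j) 0.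
  - have /cvgr_lt/(_ _ lt0) nj := @coord_cvg x j.
    near=> x' => _; have xj : val (x' : Y) 0 j < 0 by near: x'.
    by rewrite lt_eqF// !ltr0_sg.
  - have /cvgr_gt/(_ _ gt0) nj := @coord_cvg x j.
    near=> x' => _; have xj : 0 < val (x' : Y) 0 j by near: x'.
    by rewrite gt_eqF// !gtr0_sg.
  - by have := s0 j nsj; rewrite eq0 eqxx.
near=> x'; have h1 : forall i j, i \in s -> j \notin s ->
    `|val (x' : Y) 0 i| < `|val (x' : Y) 0 j|.
  by near: x'.
have h2 : forall j, j \notin s -> val (x' : Y) 0 j != 0 /\
    Num.sg (val (x' : Y) 0 j) = Num.sg (val x 0 j) by near: x'.
split; first by apply/separatesP; split=> // j /h2[].
apply/rowP => j; rewrite !mxE; case: ifPn => // /h2[_ ->]//.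
Unshelve. all: by end_near. Qed.

Definition stratum (k : nat) : set Y :=
  [set x | exists s : {set 'I_r}, #|s| = k /\ separates s (val x)].

Lemma stratum_open k : open (stratum k).
Proof.
rewrite openE => x [s [sk sx]]; apply: filterS (separates_near sx) => x' [sx' _].
by exists s.
Qed.

Lemma stratum_null_homotopic k : (k <= 2)%N -> null_homotopic_in R (stratum k).
Proof.
move=> k2; have sep (u : stratum k) : exists s : {set 'I_r},
    #|s| = k /\ separates s (val (val u)) by case: u => x /= /set_mem.
pose s u := projT1 (cid (sep u)).
have sP u : #|s u| = k /\ separates (s u) (val (val u)).
  by rewrite /s; case: cid.
(* As [k <= 2 < r], some coordinate lies outside [s u] and dominates those inside; sending the
   latter to -1 therefore moves no coordinate already at -1 or 1. *)
have nfree u i : i \in s u -> `|val (val u) 0 i| < 1.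
  move=> si; have [su /separatesP[sx _]] := sP u.
  have [j sj] : exists j, j \notin s u.
    apply/existsP; rewrite -negb_forall; apply/negP => /forallP all_s.
    have : (#|'I_r| <= k)%N by rewrite -su; apply/subset_leq_card/fintype.subsetP.
    by rewrite card_ord; lia.
  apply: lt_le_trans (sx _ _ si sj) _.
  by have [x1 _] := set_typeP Kdown (val u); rewrite ler_norml; exact: x1.
apply: (@null_homotopic_to_vertices _ (fun u => vertex (s u) (val (val u)))).
- by exists [set Ordinal (ltn_trans (ltn0Sn 1) r_gt2)]%SET; exact: K1.
- move=> u; have [su /separates_near nu] := sP u.
  have : \forall u' \near u, separates (s u) (val (val (u' : stratum k))) /\
      vertex (s u) (val (val (u' : stratum k))) = vertex (s u) (val (val u)).
    exact: (@initial_continuous _ _ (set_val : stratum k -> Y) u _ nu).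
  apply: filterS => u' [su' <-]; congr vertex; have [sk' sx'] := sP u'.
  by apply: separates_inj sx' su'; rewrite sk'.
- move=> u i; rewrite mxE; have [_ /separatesP[_ s0]] := sP u.
  case: ifPn => [_|/s0]; first by left.
  by case: sgrP => //; auto.
- move=> u i xi; rewrite mxE ifN; last first.
    apply/negP => /nfree; case: xi => ->; rewrite ?normrN normr1 ltxx//.
  by case: xi => ->; rewrite ?sgrN sgr1.
Qed.

Lemma strata_cover (x : Y) : exists2 k, (k <= 2)%N & stratum k x.
Proof.
have [x1 xK] := set_typeP Kdown x; exists #|free_coords (val x)|; first exact: K2.
exists (free_coords (val x)); split=> //; apply/separatesP.
have fixed j : j \notin free_coords (val x) -> `|val x 0 j| = 1.
  rewrite inE => nx; have := x1 j; move: nx; rewrite !le_eqVlt.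
  case: eqVneq => [<-|_]; first by rewrite normrN normr1.
  by case: eqVneq => [->|_]; [rewrite normr1|move=> /= /negbTE ->].
split=> [i j|j /fixed xj]; last by rewrite -normr_gt0 xj.
by rewrite inE => xi /fixed ->; rewrite ltr_norml.
Qed.

Lemma categorical_cover3 : has_categorical_cover R Y 3.
Proof.
exists (fun i : 'I_3 => stratum i); split=> [i|].
  split; first exact: stratum_open.
  by apply: stratum_null_homotopic; rewrite -ltnS.
apply/seteqP; split=> // x _; have [k k2 xk] := strata_cover x.
by exists (inord k) => //=; rewrite inordK.
Qed.

End UpperBound.

(** * Edges of a convex polygon *)

Section Plane.
Variable R : realType.
Implicit Types (x y u v w z : 'rV[R]_2) (c d : 'cV[R]_2) (b t : R).

Definition dot x c : R := (x *m c) 0 0.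

Lemma dotE x c : dot x c = x 0 0 * c 0 0 + x 0 1 * c 1 0.
Proof.
by rewrite /dot mxE !big_ord_recl big_ord0 addr0; congr (_ * _ + _ * _);
  congr (_ _ _); apply: val_inj.
Qed.

Lemma dotB x y c : dot (x - y) c = dot x c - dot y c.
Proof. by rewrite /dot mulmxBl !mxE. Qed.

Lemma row2P x y : x 0 0 = y 0 0 -> x 0 1 = y 0 1 -> x = y.
Proof.
move=> x0 x1; apply/rowP => -[[|[|//]] i].
  by rewrite (_ : Ordinal i = 0)//; apply: val_inj.
by rewrite (_ : Ordinal i = 1)//; apply: val_inj.
Qed.

Lemma col2_neq0 c : c != 0 -> 0 < c 0 0 ^+ 2 + c 1 0 ^+ 2.
Proof.
move=> c0; rewrite lt_neqAle addr_ge0 ?sqr_ge0// andbT eq_sym.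
apply: contra c0; rewrite paddr_eq0 ?sqr_ge0// !sqrf_eq0 => /andP[/eqP c0 /eqP c1].
apply/eqP/colP => -[[|[|//]] i]; rewrite mxE.
  by rewrite (_ : Ordinal i = 0)//; apply: val_inj.
by rewrite (_ : Ordinal i = 1)//; apply: val_inj.
Qed.

(** Both normals are orthogonal to [u - v], hence parallel; the multiplier [k] is the projection
    coefficient of [d] on [c]. *)
Lemma same_line u v c d b t : u != v -> c != 0 -> dot u c = b -> dot v c = b ->
  dot u d = t -> dot v d = t ->
  exists k, forall x, dot x d - t = k * (dot x c - b).
Proof.
move=> uv /col2_neq0; rewrite !dotE; set n := _ + _ => n0 uc vc ud vd.
have det0 : c 0 0 * d 1 0 - c 1 0 * d 0 0 = 0.
  apply/eqP; apply: contraNT uv => D0; apply/eqP.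
  have uvc : u 0 0 * c 0 0 + u 0 1 * c 1 0 - (v 0 0 * c 0 0 + v 0 1 * c 1 0) = 0.
    by rewrite uc vc subrr.
  have uvd : u 0 0 * d 0 0 + u 0 1 * d 1 0 - (v 0 0 * d 0 0 + v 0 1 * d 1 0) = 0.
    by rewrite ud vd subrr.
  apply: row2P; apply: (mulIf D0); apply/eqP; rewrite -subr_eq0; apply/eqP.
    rewrite -[RHS](_ : d 1 0 * 0 - c 1 0 * 0 = 0); last by rewrite !mulr0 subrr.
    by rewrite -[in d 1 0 * 0]uvc -[in c 1 0 * 0]uvd; ring.
  rewrite -[RHS](_ : c 0 0 * 0 - d 0 0 * 0 = 0); last by rewrite !mulr0 subrr.
  by rewrite -[in d 0 0 * 0]uvc -[in c 0 0 * 0]uvd; ring.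
exists ((c 0 0 * d 0 0 + c 1 0 * d 1 0) / n) => x; rewrite !dotE -ud -uc.
apply: (mulIf (lt0r_neq0 n0)); rewrite [RHS]mulrAC divfK ?lt0r_neq0//.
move: det0; rewrite /n; move: (x 0 0) (x 0 1) (u 0 0) (u 0 1).
move: (c 0 0) (c 1 0) (d 0 0) (d 1 0) => c0 c1 d0 d1 x0 x1 u0 u1 det0.
have -> : (x0 * d0 + x1 * d1 - (u0 * d0 + u1 * d1)) * (c0 ^+ 2 + c1 ^+ 2) =
  (c0 * d0 + c1 * d1) * (x0 * c0 + x1 * c1 - (u0 * c0 + u1 * c1))
  + (c0 * d1 - c1 * d0) * ((x1 - u1) * c0 - (x0 - u0) * c1) by ring.
by rewrite det0 mul0r addr0.
Qed.

Variable P : set 'rV[R]_2.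
Hypothesis Pfull : forall c b, c != 0 -> ~ (forall x, P x -> dot x c = b).

Definition edge c b (F : set 'rV[R]_2) : Prop :=
  [/\ c != 0, forall x, P x -> dot x c <= b,
      F = P `&` [set x | dot x c = b] & exists u v, [/\ F u, F v & u != v]].

Lemma edge_eq c d b t (F G : set 'rV[R]_2) u v : edge c b F -> edge d t G ->
  u != v -> F u -> F v -> G u -> G v -> F = G.
Proof.
move=> [c0 _ -> _] [d0 _ -> _] uv [Pu uc] [Pv vc] [_ ud] [_ vd].
have [k kP] := same_line uv c0 uc vc ud vd.
have k0 : k != 0.
  apply/eqP => k0; apply: (Pfull (b := t) d0) => x _; apply/eqP.
  by rewrite -subr_eq0 kP k0 mul0r.
apply/seteqP; split=> x [Px /= xl]; split=> //=; apply/eqP.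
  by rewrite -subr_eq0 kP xl subrr mulr0.
by have := kP x; rewrite xl subrr => /esym/eqP; rewrite mulf_eq0 (negbTE k0) subr_eq0.
Qed.

Lemma edge_other_pt c b F z : edge c b F -> F z -> exists2 u, F u & u != z.
Proof.
move=> [_ _ _ [u [v [Fu Fv uv]]]] Fz.
by have [uz|] := eqVneq u z; [exists v; rewrite // -uz eq_sym|exists u].
Qed.

(** Directions [w1], [w2], [w3] from [z] along the edges satisfy a linear relation with cross
    products as coefficients. Each normal kills its own direction and is negative on the other two,
    so the coefficients have pairwise opposite signs. Thus all vanish, and [w2], parallel to [w1],
    is killed by [c1]: a contradiction. *)
Lemma no_three_edges c1 b1 F1 c2 b2 F2 c3 b3 F3 z :
  edge c1 b1 F1 -> edge c2 b2 F2 -> edge c3 b3 F3 ->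
  F1 <> F2 -> F2 <> F3 -> F1 <> F3 -> F1 z -> F2 z -> F3 z -> False.
Proof.
move=> E1 E2 E3 n12 n23 n13 z1 z2 z3.
have [u1 Fu1 u1z] := edge_other_pt E1 z1.
have [u2 Fu2 u2z] := edge_other_pt E2 z2.
have [u3 Fu3 u3z] := edge_other_pt E3 z3.
have strict c b F d t G u : edge c b F -> edge d t G -> F <> G -> F z -> G z ->
    F u -> u != z -> dot (u - z) c = 0 /\ dot (u - z) d < 0.
  move=> EF EG FG Fz Gz Fu uz; have [_ _ FE _] := EF; have [_ Gs GE _] := EG.
  have Pu : P u by move: Fu; rewrite FE => -[].
  have zc : dot z c = b by move: Fz; rewrite FE => -[].
  have uc : dot u c = b by move: Fu; rewrite FE => -[].
  have zd : dot z d = t by move: Gz; rewrite GE => -[].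
  rewrite !dotB zc uc zd subrr; split=> //; rewrite subr_lt0 lt_neqAle Gs// andbT.
  apply/eqP => ud; apply: FG; apply: (edge_eq EF EG uz) => //.
  by rewrite GE; split.
have [a1 a12] := strict _ _ _ _ _ _ _ E1 E2 n12 z1 z2 Fu1 u1z.
have [_ a13] := strict _ _ _ _ _ _ _ E1 E3 n13 z1 z3 Fu1 u1z.
have [a2 a21] := strict _ _ _ _ _ _ _ E2 E1 (nesym n12) z2 z1 Fu2 u2z.
have [_ a23] := strict _ _ _ _ _ _ _ E2 E3 n23 z2 z3 Fu2 u2z.
have [a3 a31] := strict _ _ _ _ _ _ _ E3 E1 (nesym n13) z3 z1 Fu3 u3z.
have [_ a32] := strict _ _ _ _ _ _ _ E3 E2 (nesym n23) z3 z2 Fu3 u3z.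
move: (u1 - z) (u2 - z) (u3 - z) a1 a12 a13 a2 a21 a23 a3 a31 a32.
move=> w1 w2 w3; pose cr x y : R := x 0 0 * y 0 1 - x 0 1 * y 0 0.
have dep c : cr w2 w3 * dot w1 c + cr w3 w1 * dot w2 c + cr w1 w2 * dot w3 c = 0.
  by rewrite /cr !dotE; ring.
move: (dep c1) (dep c2) (dep c3) => d1 d2 d3.
move=> e1 a12 a13 e2 a21 a23 e3 a31 a32.
rewrite e1 mulr0 add0r in d1; rewrite e2 mulr0 addr0 in d2.
rewrite e3 mulr0 addr0 in d3.
have sgn (a A k B : R) : A < 0 -> B < 0 -> a * A + k * B = 0 ->
    [/\ 0 < a -> k < 0, a < 0 -> 0 < k & a = 0 -> k = 0].
  move=> A0 B0 ak; split=> [a0|a0|a0].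
  - rewrite ltNge; apply/negP => k0.
    have := mulr_ge0_le0 k0 (ltW B0); have : a * A < 0 by rewrite pmulr_rlt0.
    by lra.
  - rewrite ltNge; apply/negP => k0.
    have := mulr_le0 k0 (ltW B0); have : 0 < a * A by rewrite nmulr_rgt0.
    by lra.
  - move: ak; rewrite a0 mul0r add0r => /eqP.
    by rewrite mulf_eq0 (lt_eqF B0) orbF => /eqP.
have [p12 n12' z12] := sgn _ _ _ _ a13 a23 d3.
have [p13 n13' _] := sgn _ _ _ _ a12 a32 d2.
have [p23 n23' z23] := sgn _ _ _ _ a21 a31 d1.
have [q1|q1|q1] := ltgtP (cr w2 w3) 0.
- by have := p23 (n12' q1); have := n13' q1; lra.
- by have := n23' (p12 q1); have := p13 q1; lra.
have q3 := z23 (z12 q1).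
have [c10 _ _ _] := E1.
have w10 : w1 != 0.
  apply/eqP => w10; move: a12; rewrite w10 dotE !mxE !mul0r addr0 ltxx//.
have : dot w2 c1 * (w1 0 0 ^+ 2 + w1 0 1 ^+ 2) = 0.
  move: q3 e1; rewrite /cr !dotE => q3 e1.
  have -> : (w2 0 0 * c1 0 0 + w2 0 1 * c1 1 0) * (w1 0 0 ^+ 2 + w1 0 1 ^+ 2) =
    (w1 0 0 * c1 0 0 + w1 0 1 * c1 1 0) * (w1 0 0 * w2 0 0 + w1 0 1 * w2 0 1)
    + (w1 0 0 * w2 0 1 - w1 0 1 * w2 0 0) * (w1 0 0 * c1 1 0 - w1 0 1 * c1 0 0) by ring.
  by rewrite e1 q3 !mul0r addr0.
move/eqP; rewrite mulf_eq0 (lt_eqF a21)/= paddr_eq0 ?sqr_ge0// !sqrf_eq0.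
move=> /andP[/eqP x0 /eqP x1]; move/eqP: w10; apply.
by apply: row2P; rewrite mxE.
Qed.

End Plane.

Lemma seq_argmin (R : realDomainType) (T : eqType) (s : seq T) (p : pred T)
    (f : T -> R) : has p s ->
  exists x, [/\ x \in s, p x & forall y, y \in s -> p y -> f x <= f y].
Proof.
elim: s => //= a s IH; case: (boolP (has p s)) => [/IH[x [xs px xmin]] _|nps].
  have [pa|npa] := boolP (p a); last first.
    exists x; rewrite inE xs orbT; split=> // y; rewrite inE => /predU1P[->|].
      by rewrite (negbTE npa).
    exact: xmin.
  have [ax|xa] := lerP (f a) (f x).
    exists a; rewrite inE eqxx; split=> // y; rewrite inE => /predU1P[->//|ys py].
    exact: le_trans ax (xmin y ys py).
  exists x; rewrite inE xs orbT; split=> // y; rewrite inE => /predU1P[-> _|].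
    exact: ltW.
  exact: xmin.
rewrite orbF => pa; exists a; rewrite inE eqxx; split=> // y.
rewrite inE => /predU1P[->//|ys py].
by move: nps => /hasPn/(_ y ys); rewrite py.
Qed.

Section Polygon.
Variable R : realType.
Implicit Types (x y u v w z : 'rV[R]_2) (c d : 'cV[R]_2) (b t : R).
Variables (P : set 'rV[R]_2) (s : seq 'rV[R]_2).
Hypothesis PE : P = smallest (@convex_set R 'rV[R]_2) [set` s].
Hypothesis Pfull : forall c b, c != 0 -> ~ (forall x, P x -> dot x c = b).

Local Notation edge := (edge P).

Lemma dotN x c : dot x (- c) = - dot x c.
Proof. by rewrite /dot mulmxN !mxE. Qed.

Lemma generator_in x : x \in s -> P x.
Proof. by move=> xs; rewrite PE => A [_ sA]; exact: sA. Qed.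

Lemma half_plane c b : (forall x, x \in s -> dot x c <= b) ->
  forall x, P x -> dot x c <= b.
Proof.
move=> sb x; rewrite PE => /(_ [set y | dot y c <= b]); apply; split => //.
move=> y z l /set_mem yb /set_mem zb; apply/mem_set; move: yb zb => /=.
have l0 : 0 <= l%:num by [].
have l1 : 0 <= 1 - l%:num by rewrite subr_ge0.
rewrite /dot/= => yb zb; rewrite mulmxDl -!scalemxAl !mxE.
rewrite (_ : b = l%:num * b + (1 - l%:num) * b); last by ring.
by move: yb zb; rewrite !mxE => yb zb; apply: lerD; apply: ler_wpM2l.
Qed.

(* Rotating the supporting line of an edge about its endpoint [u], where
   [dot _ d] is minimal, until it meets another generator. *)
Lemma edge_neighbor c b F d : edge c b F -> d != 0 ->
    d 0 0 * c 0 0 + d 1 0 * c 1 0 = 0 ->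
  exists u c' b' G, [/\ edge c' b' G, F <> G, F u, G u &
    forall x, F x -> dot u d <= dot x d].
Proof.
move=> [c0 Pb FE [x0 [y0 [Fx0 Fy0 xy0]]]] d0 dc.
have Fx x : F x -> P x /\ dot x c = b by rewrite FE.
have on_line : has (fun p => dot p c == b) s.
  apply/negPn/negP => /hasPn noline.
  have [t tb tP] : exists2 t, t < b & forall x, x \in s -> dot x c <= t.
    have [/(seq_argmin (fun p => - dot p c))[q [qs _ qmin]]|/hasPn s0] :=
      boolP (has predT s).
      exists (dot q c); last by move=> x /qmin/(_ isT); rewrite lerN2.
      by rewrite lt_neqAle noline// Pb//; exact: generator_in.
    by exists (b - 1) => [|x /s0//]; lra.
  have [Px0 x0b] := Fx _ Fx0.
  by have := half_plane tP Px0; rewrite x0b leNgt tb.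
have off_line : has (fun p => dot p c < b) s.
  apply/negPn/negP => /hasPn noff; apply: (Pfull (b := b) c0) => x Px.
  apply/eqP; rewrite eq_le Pb//= -lerN2 -dotN.
  by apply: half_plane Px => p ps; rewrite dotN lerN2 leNgt; exact: noff.
have [u [us /eqP uc umin]] := seq_argmin (fun p => dot p d) on_line.
(* For [M = slope p] the normal [M *: c - d] takes equal values at [p] and [u]. The largest slope
   keeps all generators on one side. *)
pose slope p := (dot u d - dot p d) / (b - dot p c).
have [q [qs qc qmax]] := seq_argmin (fun p => - slope p) off_line.
pose M := slope q; pose c' := M *: c - d; pose b' := M * b - dot u d.
have c'E x : dot x c' = M * dot x c - dot x d.
  by rewrite /c' /dot mulmxBr -scalemxAr !mxE.
have Ps p : p \in s -> dot p c' <= b'.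
  move=> ps; rewrite c'E /b'.
  have := Pb _ (generator_in ps); rewrite le_eqVlt => /predU1P[pc|pc].
    by have := umin p ps; rewrite pc eqxx => /(_ isT); lra.
  have := qmax p ps pc; rewrite lerN2 -/M /slope ler_pdivrMr ?subr_gt0//; lra.
have qc' : dot q c' = b'.
  rewrite c'E /b' /M /slope.
  have nz : b - dot q c != 0 by rewrite subr_eq0 gt_eqF.
  by field.
have uc' : dot u c' = b' by rewrite c'E uc.
have c'0 : c' != 0.
  apply/eqP => c'0; have := col2_neq0 d0.
  have dM i : d i 0 = M * c i 0.
    by move/matrixP: c'0 => /(_ i 0); rewrite !mxE => /eqP; rewrite subr_eq0 => /eqP.
  have -> : d 0 0 ^+ 2 + d 1 0 ^+ 2 = M * (d 0 0 * c 0 0 + d 1 0 * c 1 0).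
    rewrite !expr2 mulrDr; congr (_ + _).
      by rewrite {2}(dM 0) mulrCA.
    by rewrite {2}(dM 1) mulrCA.
  by rewrite dc mulr0 ltxx.
have nuq : u != q by apply: contraTneq qc => <-; rewrite uc ltxx.
exists u, c', b', (P `&` [set x | dot x c' = b']); split.
- split=> //; first exact: half_plane.
  by exists u, q; split=> //; split=> //; exact: generator_in.
- move=> FG; have : F q by rewrite FG; split=> //; exact: generator_in.
  by move=> /Fx[_ qb]; move: qc; rewrite qb ltxx.
- by rewrite FE; split=> //; exact: generator_in.
- by split=> //; exact: generator_in.
- move=> x /Fx[Px xb]; have := half_plane Ps Px.
  by rewrite c'E /b' xb; lra.
Qed.

(** [edge_neighbor] for [d], the quarter turn of [c], and for [- d] gives a neighbour at each end of
    [F]. Another edge through an end would make three there; one through an inner point has a linear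
    function maximal inside [F], hence constant on [F], so it is [F]. *)
Lemma edge_two_neighbors c b F : edge c b F ->
  exists G H, [/\ exists c1 b1, edge c1 b1 G, exists c2 b2, edge c2 b2 H,
    [/\ G <> H, F <> G & F <> H], F `&` G !=set0 /\ F `&` H !=set0 &
    forall c' b' I, edge c' b' I -> F <> I -> F `&` I !=set0 -> I = G \/ I = H].
Proof.
move=> EF; have [c0 Pb FE [x0 [y0 [Fx0 Fy0 xy0]]]] := EF.
have Fx x : F x -> P x /\ dot x c = b by rewrite FE.
pose d : 'cV[R]_2 := \col_i (if i == 0 then - c 1 0 else c 0 0).
have d0E : d 0 0 = - c 1 0 by rewrite mxE.
have d1E : d 1 0 = c 0 0 by rewrite mxE.
have n0 := col2_neq0 c0; set n := _ + _ in n0.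
have d0 : d != 0.
  apply/eqP => d0; move: d0E d1E n0; rewrite d0 !mxE /n => /esym/eqP.
  by rewrite oppr_eq0 => /eqP -> <-; rewrite expr0n /= addr0 ltxx.
have dc : d 0 0 * c 0 0 + d 1 0 * c 1 0 = 0 by rewrite d0E d1E; ring.
have param x c' : dot x c = b -> n * dot x c' =
    b * (c 0 0 * c' 0 0 + c 1 0 * c' 1 0) + dot x d * (d 0 0 * c' 0 0 + d 1 0 * c' 1 0).
  by move=> <-; rewrite !dotE d0E d1E /n; ring.
have inj x y : dot x c = b -> dot y c = b -> dot x d = dot y d -> x = y.
  move=> xc yc xy; apply: row2P; apply: (mulfI (lt0r_neq0 n0)).
    have E z : n * z 0 0 = dot z c * c 0 0 + dot z d * d 0 0.
      by rewrite !dotE d0E d1E /n; ring.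
    by rewrite !E xc yc xy.
  have E z : n * z 0 1 = dot z c * c 1 0 + dot z d * d 1 0.
    by rewrite !dotE d0E d1E /n; ring.
  by rewrite !E xc yc xy.
have [u [c1 [b1 [G [EG FG Fu Gu umin]]]]] := edge_neighbor EF d0 dc.
have nd0 : - d != 0 by rewrite oppr_eq0.
have ndc : (- d) 0 0 * c 0 0 + (- d) 1 0 * c 1 0 = 0.
  by rewrite !mxE /= ; ring.
have [v [c2 [b2 [H [EH FH Fv Hv vmax]]]]] := edge_neighbor EF nd0 ndc.
have {}vmax x : F x -> dot x d <= dot v d.
  by move=> /vmax; rewrite !dotN lerN2.
have uv : dot u d < dot v d.
  rewrite lt_neqAle (le_trans (umin _ Fx0) (vmax _ Fx0)) andbT; apply/eqP => uv.
  move/eqP: xy0; apply; apply: inj; [exact: (Fx _ Fx0).2|exact: (Fx _ Fy0).2|].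
  have := umin _ Fx0; have := vmax _ Fx0; have := umin _ Fy0; have := vmax _ Fy0.
  by rewrite uv => *; apply/eqP; rewrite eq_le; apply/andP; split; lra.
have nuv : u != v by apply: contraTneq uv => ->; rewrite ltxx.
exists G, H; split.
- by exists c1, b1.
- by exists c2, b2.
- split=> // GH; apply: FG; apply: (edge_eq Pfull EF EG nuv) => //.
  by rewrite GH.
- by split; [exists u|exists v].
move=> c' b' I EI FI [z [Fz Iz]].
have [_ Pb' IE _] := EI; have [Pz zc] := Fx _ Fz; have [Pu uc] := Fx _ Fu.
have [Pv vc] := Fx _ Fv.
have zb' : dot z c' = b' by move: Iz; rewrite IE => -[].
have [zu|zu] := eqVneq (dot u d) (dot z d).
  left; have uz := inj _ _ uc zc zu; subst z; apply: contrapT => IG.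
  by apply: (no_three_edges Pfull EF EI EG (z := u)).
have [zv|zv] := eqVneq (dot v d) (dot z d).
  right; have vz := inj _ _ vc zc zv; subst z; apply: contrapT => IH.
  by apply: (no_three_edges Pfull EF EI EH (z := v)).
have uz : dot u d < dot z d by rewrite lt_neqAle zu umin.
have vz : dot z d < dot v d by rewrite lt_neqAle eq_sym zv vmax.
exfalso; apply: FI; have nuz : u != z by apply: contraNneq zu => ->.
apply: (edge_eq Pfull EF EI nuz) => //.
rewrite IE; split=> //=; apply: (mulfI (lt0r_neq0 n0)).
have hv : n * dot v c' <= n * dot z c' by rewrite ler_pM2l// zb' Pb'.
have hu : n * dot u c' <= n * dot z c' by rewrite ler_pM2l// zb' Pb'.
rewrite -zb' !param//; rewrite !param// in hv hu.
move: hv hu; rewrite !lerD2l; set k := d 0 0 * _ + _ => hv hu.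
suff -> : k = 0 by rewrite !mulr0.
have [k0|k0|//] := ltgtP k 0.
  by move: hu; rewrite ler_nM2r// leNgt uz.
by move: hv; rewrite ler_pM2r// leNgt vz.
Qed.

(* The affine function vanishing on a fourth edge is a nonnegative combination
   of those of the three edges, so theirs vanish on it wherever the coefficient
   is nonzero. *)
Lemma triangle_edges c1 b1 F1 c2 b2 F2 c3 b3 F3 c4 b4 F4 :
  edge c1 b1 F1 -> edge c2 b2 F2 -> edge c3 b3 F3 -> edge c4 b4 F4 ->
  F1 <> F2 -> F2 <> F3 -> F1 <> F3 ->
  F1 `&` F2 !=set0 -> F2 `&` F3 !=set0 -> F1 `&` F3 !=set0 ->
  [\/ F4 = F1, F4 = F2 | F4 = F3].
Proof.
move=> E1 E2 E3 E4 n12 n23 n13 [z3 [z31 z32]] [z1 [z12 z13]] [z2 [z21 z23]].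
have strict c b F z G c' b' G' c'' b'' : edge c b F -> edge c' b' G ->
    edge c'' b'' G' -> F <> G -> G <> G' -> F <> G' -> G z -> G' z ->
    0 < b - dot z c /\ (dot z c' = b' /\ dot z c'' = b'').
  move=> EF EG EG' FG GG' FG' Gz Gz'; have [_ Pb FE _] := EF.
  have [_ _ GE _] := EG; have [_ _ GE' _] := EG'.
  have Pz : P z by move: Gz; rewrite GE => -[].
  split; last by split; [move: Gz; rewrite GE => -[]|move: Gz'; rewrite GE' => -[]].
  rewrite subr_gt0 lt_neqAle Pb// andbT; apply/eqP => zc.
  apply: (no_three_edges Pfull EF EG EG' FG GG' FG' _ Gz Gz').
  by rewrite FE; split.
have [p1 [e12 e13]] := strict _ _ _ _ _ _ _ _ _ _ E1 E2 E3 n12 n23 n13 z12 z13.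
have [p2 [e21 e23]] := strict _ _ _ _ _ _ _ _ _ _ E2 E1 E3 (nesym n12) n13 n23 z21 z23.
have [p3 [e31 e32]] := strict _ _ _ _ _ _ _ _ _ _ E3 E1 E2
  (nesym n13) n12 (nesym n23) z31 z32.
have [c40 Pb4 FE4 [p [q [Fp Fq pq]]]] := E4.
have [Pp p4] : P p /\ dot p c4 = b4 by move: Fp; rewrite FE4.
have [Pq q4] : P q /\ dot q c4 = b4 by move: Fq; rewrite FE4.
(* The coefficients are forced by evaluating at [z1], [z2], [z3]: each lies on two of the three
   edges, so a single term survives. *)
pose m1 := (b4 - dot z1 c4) / (b1 - dot z1 c1).
pose m2 := (b4 - dot z2 c4) / (b2 - dot z2 c2).
pose m3 := (b4 - dot z3 c4) / (b3 - dot z3 c3).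
have Pz c b F z : edge c b F -> F z -> P z by move=> [_ _ -> _] [].
have m1_ge0 : 0 <= m1.
  by rewrite divr_ge0 ?(ltW p1)// subr_ge0 Pb4//; exact: Pz E2 z12.
have m2_ge0 : 0 <= m2.
  by rewrite divr_ge0 ?(ltW p2)// subr_ge0 Pb4//; exact: Pz E1 z21.
have m3_ge0 : 0 <= m3.
  by rewrite divr_ge0 ?(ltW p3)// subr_ge0 Pb4//; exact: Pz E1 z31.
pose g := c4 - m1 *: c1 - m2 *: c2 - m3 *: c3.
pose t := b4 - m1 * b1 - m2 * b2 - m3 * b3.
have gE x : dot x g = dot x c4 - m1 * dot x c1 - m2 * dot x c2 - m3 * dot x c3.
  by rewrite /g /dot !mulmxBr -!scalemxAr !mxE.
have g1 : dot z1 g = t.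
  have m1E : m1 * (b1 - dot z1 c1) = b4 - dot z1 c4 by rewrite divfK ?gt_eqF.
  by rewrite gE /t e12 e13; move: m1E; rewrite mulrBr; lra.
have g2 : dot z2 g = t.
  have m2E : m2 * (b2 - dot z2 c2) = b4 - dot z2 c4 by rewrite divfK ?gt_eqF.
  by rewrite gE /t e21 e23; move: m2E; rewrite mulrBr; lra.
have g3 : dot z3 g = t.
  have m3E : m3 * (b3 - dot z3 c3) = b4 - dot z3 c4 by rewrite divfK ?gt_eqF.
  by rewrite gE /t e31 e32; move: m3E; rewrite mulrBr; lra.
have z23n : z2 != z3 by apply: contraTneq p2 => ->; rewrite e32 subrr ltxx.
have [c10 _ F1E _] := E1.
(* [g - t] vanishes at [z2] and [z3], so it is a multiple of the function of [F1]; vanishing also at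
   [z1], off that line, it is zero. *)
have [k kP] := same_line z23n c10 e21 e31 g2 g3.
have k0 : k = 0.
  have := kP z1; rewrite g1 subrr => /esym/eqP; rewrite mulf_eq0 => /orP[/eqP//|].
  by rewrite subr_eq0 -subr_eq0 -opprB oppr_eq0 (gt_eqF p1).
have comb x : b4 - dot x c4 =
    m1 * (b1 - dot x c1) + m2 * (b2 - dot x c2) + m3 * (b3 - dot x c3).
  by have := kP x; rewrite k0 mul0r gE /t !mulrBr; lra.
have vanish x : P x -> dot x c4 = b4 -> [/\ m1 != 0 -> dot x c1 = b1,
    m2 != 0 -> dot x c2 = b2 & m3 != 0 -> dot x c3 = b3].
  move=> Px x4; have := comb x; rewrite x4 subrr => /esym.
  have nn m c b F : edge c b F -> 0 <= m -> 0 <= m * (b - dot x c).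
    by move=> [_ Pb _ _] m0; rewrite mulr_ge0// subr_ge0 Pb.
  have h1 := nn _ _ _ _ E1 m1_ge0; have h2 := nn _ _ _ _ E2 m2_ge0.
  have h3 := nn _ _ _ _ E3 m3_ge0 => h.
  have z m b c : m * (b - dot x c) = 0 -> m != 0 -> dot x c = b.
    by move=> /eqP; rewrite mulf_eq0 => /orP[-> //|]; rewrite subr_eq0 => /eqP.
  by split; apply: z; lra.
have [p1' p2' p3'] := vanish p Pp p4; have [q1' q2' q3'] := vanish q Pq q4.
have eqF c b F : edge c b F -> dot p c = b -> dot q c = b -> F4 = F.
  move=> EF pc qc; apply: (edge_eq Pfull E4 EF pq) => //; have [_ _ -> _] := EF.
    by split.
  by split.
have [m10|m10] := eqVneq m1 0; last by apply: Or31; exact: eqF E1 (p1' m10) (q1' m10).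
have [m20|m20] := eqVneq m2 0; last by apply: Or32; exact: eqF E2 (p2' m20) (q2' m20).
have [m30|m30] := eqVneq m3 0; last by apply: Or33; exact: eqF E3 (p3' m30) (q3' m30).
exfalso; apply: (Pfull (b := b4) c40) => x _; have := comb x.
by rewrite m10 m20 m30 !mul0r !addr0; lra.
Qed.

End Polygon.

(** * Facets of a plane polygon as edges *)

Section Facets.
Variable R : realType.
Implicit Types (A P F : set 'rV[R]_2) (c : 'cV[R]_2) (b : R).

Lemma affdim_ge2_not_line A c b : affdim_ge A 2 -> c != 0 ->
  ~ (forall x, A x -> dot x c = b).
Proof.
move=> [p [Ap]]; set M := \matrix_i _; rewrite row_free_unit => Mu c0 Ac.
move/eqP: c0; apply; rewrite -(mulKmx Mu c) (_ : M *m c = 0) ?mulmx0//.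
apply/row_matrixP => i; rewrite row_mul rowK linear0; apply/rowP => j.
by rewrite ord1 [RHS]mxE -/(dot _ _) dotB !Ac// subrr.
Qed.

Lemma affdim_ge_le2 A k : affdim_ge A k -> (k <= 2)%N.
Proof. by move=> [p [_ /eqP <-]]; exact: rank_leq_col. Qed.

Lemma affdim_ge1P A : affdim_ge A 1 <-> exists u v, [/\ A u, A v & u != v].
Proof.
have mxE1 (p : 'I_2 -> 'rV[R]_2) :
    \matrix_(i < 1) (p (lift ord0 i) - p ord0) = p (lift ord0 ord0) - p ord0.
  by apply/row_matrixP => i; rewrite rowK ord1 row_id.
split=> [[p [Ap]]|[u [v [Au Av uv]]]].
  rewrite mxE1 /row_free rank_rV subr_eq0; case: eqVneq => //= p01 _.
  exists (p (lift ord0 ord0)), (p ord0).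
  by split; [exact: Ap|exact: Ap|move: p01; case: (_ != _)].
pose p (i : 'I_2) := if i == ord0 then u else v.
exists p; split=> [i|]; first by rewrite /p; case: ifP.
by rewrite (mxE1 p) /row_free rank_rV subr_eq0 /p /= [v == u]eq_sym uv.
Qed.

Lemma facet_edgeP P F : has_affdim P 2 ->
  is_facet P F <-> exists c b, edge P c b F.
Proof.
move=> [P2 P3]; split=> [[[c [b [Pb FE]]] [d [[Pd Pd1] [Fd Fd1]]]]|].
  have d1 : d = 1%N.
    have := affdim_ge_le2 Pd; case: d Pd1 {Pd Fd Fd1} => [|[|//]] //.
  rewrite {}d1 in Fd Fd1 Pd Pd1; have [u [v [Fu Fv uv]]] := (affdim_ge1P F).1 Fd.
  have c0 : c != 0.
    apply/eqP => c0; apply: Fd1; suff -> : F = P by [].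
    move: Fu; rewrite FE c0 => -[Pu /=]; rewrite mulmx0 mxE => b0.
    by apply/seteqP; split=> [x []//|x Px]; split=> //=; rewrite mulmx0 mxE.
  by exists c, b; split=> //; exists u, v.
move=> [c [b [c0 Pb FE Fuv]]]; split; first by exists c, b.
exists 1%N; split=> //; split; first exact/affdim_ge1P.
by move=> F2; apply: (affdim_ge2_not_line (b := b) F2 c0) => x; rewrite FE => -[].
Qed.

End Facets.

(** * Combinatorics of the facet complex of a polygon *)

Section Gon.
Variables (R : realType) (r : nat) (P : set 'rV[R]_2) (F : 'I_r -> set 'rV[R]_2).
Hypothesis hP : is_gon P F.

Local Notation K := (facet_complex F).

Let Pfull c b : c != 0 -> ~ (forall x, P x -> dot x c = b).
Proof. by case: hP => _ [P2 _] _ _; exact: affdim_ge2_not_line. Qed.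

Let F_edge i : exists c b, edge P c b (F i).
Proof. by case: hP => _ P2 _ FP; apply/facet_edgeP => //; apply/FP; exists i. Qed.

Let edge_F c b G : edge P c b G -> exists i, F i = G.
Proof. by case: hP => _ P2 _ FP EG; apply/FP/facet_edgeP => //; exists c, b. Qed.

Let F_neq i j : i != j -> F i <> F j.
Proof. by case: hP => _ _ Finj _; apply: contra_neq_not => /Finj. Qed.

Lemma facet_complex_down (s t : {set 'I_r}) : K s -> t \subset s -> K t.
Proof.
move=> [x Fx] /fintype.subsetP ts; exists x => i /= it.
by apply: Fx => /=; exact: ts.
Qed.

Lemma facet_complex1 i : K [set i]%SET.
Proof.
have [c [b [_ _ _ [u [_ [Fu _ _]]]]]] := F_edge i.
by exists u => j /=; rewrite inE => /eqP ->.
Qed.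

Lemma facet_complex2 i j : K [set i; j]%SET <-> F i `&` F j !=set0.
Proof.
split=> [[x Fx]|[x [Fi Fj]]]; last first.
  by exists x => k /=; rewrite !inE => /orP[] /eqP ->.
by exists x; split; apply: Fx; rewrite /= !inE eqxx ?orbT.
Qed.

Lemma adjacentP i j : adjacent K i j <-> i <> j /\ F i `&` F j !=set0.
Proof.
split=> [/andP[/eqP ij /set_mem/facet_complex2 //]|[/eqP ij Fij]].
by apply/andP; split=> //; apply/mem_set/facet_complex2.
Qed.

Lemma facet_complex_card s : K s -> (#|s| <= 2)%N.
Proof.
move=> [z Fz]; rewrite leqNgt; apply/negP => /card_gt2P.
move=> [i [j [k [[si sj sk] [/F_neq ij /F_neq jk]]]]].
rewrite eq_sym => /F_neq ik.
have [c1 [b1 E1]] := F_edge i; have [c2 [b2 E2]] := F_edge j.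
have [c3 [b3 E3]] := F_edge k.
by apply: (no_three_edges Pfull E1 E2 E3 ij jk ik (z := z)); exact: Fz.
Qed.

Lemma facet_neighbors j : exists k l, k != l /\
  forall i, adjacent K i j = (i == k) || (i == l).
Proof.
have [[s PE] _ _ _] := hP; have [c [b Ej]] := F_edge j.
have [G [H [[c1 [b1 EG]] [c2 [b2 EH]] [GH FG FH] [FGx FHx] nbr]]] :=
  edge_two_neighbors PE Pfull Ej.
have [k Fk] := edge_F EG; have [l Fl] := edge_F EH; exists k, l.
split; first by apply/eqP => kl; apply: GH; rewrite -Fk -Fl kl.
move=> i; apply/idP/orP => [/adjacentP[/eqP ij Fij]|].
  have [c3 [b3 Ei]] := F_edge i; have Finj : injective F by case: hP.
  have := nbr _ _ _ Ei; case; first by apply: F_neq; rewrite eq_sym.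
  - by rewrite setIC.
  - by rewrite -Fk => /Finj ->; left.
  - by rewrite -Fl => /Finj ->; right.
case=> /eqP ->; apply/adjacentP; rewrite ?Fk ?Fl setIC; split=> //.
  by move=> kj; apply: FG; rewrite -Fk kj.
by move=> lj; apply: FH; rewrite -Fl lj.
Qed.

Lemma facet_neighbors_even j : ~~ odd #|[pred i | adjacent K i j]|.
Proof.
have [k [l [kl E]]] := facet_neighbors j.
by rewrite (eq_card (B := pred2 k l)) ?card2 ?kl// => i; rewrite inE E.
Qed.

Lemma facet_no_triangle i j k : (3 < r)%N -> adjacent K i j ->
  ~~ (adjacent K i k && adjacent K j k).
Proof.
move=> r3 /adjacentP[/eqP/F_neq nij Fij]; apply/negP => /andP[].
move=> /adjacentP[/eqP/F_neq nik Fik] /adjacentP[/eqP/F_neq njk Fjk].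
have [_ _ Finj _] := hP.
have [l nl] : exists l, l \notin [set i; j; k]%SET.
  apply/existsP; rewrite -negb_forall; apply/negP => /forallP all3.
  have : (#|'I_r| <= #|[set i; j; k]%SET|)%N.
    by apply/subset_leq_card/fintype.subsetP.
  rewrite card_ord => /(leq_trans r3); rewrite ltnNge => /negP; apply.
  apply: leq_trans (leq_card_setU _ _) _; rewrite cards1 addn1 ltnS cards2.
  by case: (i != j).
have [c1 [b1 E1]] := F_edge i; have [c2 [b2 E2]] := F_edge j.
have [c3 [b3 E3]] := F_edge k; have [c4 [b4 E4]] := F_edge l.
move: nl; rewrite !inE !negb_or => /andP[/andP[li lj] lk].
have [] := triangle_edges Pfull E1 E2 E3 E4 nij njk nik Fij Fjk Fik.
- by move/Finj/eqP; rewrite (negbTE li).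
- by move/Finj/eqP; rewrite (negbTE lj).
- by move/Finj/eqP; rewrite (negbTE lk).
Qed.

End Gon.

Theorem proposition3p7 (R : realType) (r : nat) (P : set 'rV[R]_2)
    (F : 'I_r -> set 'rV[R]_2) (hr : (3 < r)%N) (hP : is_gon P F) :
  LScat R (real_moment_angle R (facet_complex F)) = (3%N)%:E.
Proof.
have Kdown := @facet_complex_down R r F.
have cover3 : has_categorical_cover R (real_moment_angle R (facet_complex F)) 3.
  apply: categorical_cover3 => //.
  - exact: facet_complex1 hP.
  - exact: facet_complex_card hP.
  - exact: ltnW.
have no_cover (U V : set (real_moment_angle R (facet_complex F))) :
    open U -> open V -> null_homotopic_in R U -> null_homotopic_in R V ->
    U `|` V <> setT.
  pose p : 'I_r := Ordinal (ltn_trans (ltn0Sn 2) hr).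
  have [q [q' [_ Eq]]] := facet_neighbors hP p.
  have pq : adjacent (facet_complex F) p q by rewrite adjacent_sym Eq eqxx.
  apply: (no_two_set_cover Kdown (facet_neighbors_even hP) pq) => k.
  exact: (facet_no_triangle hP k hr pq).
rewrite /LScat; case: pselect => [h|]; last first.
  by case; exists 3; rewrite /=; apply/asboolP.
congr (_%:E); case: ex_minnP => m /andP[m0 /asboolP[U [Uc Ucov]]] mmin.
apply/eqP; rewrite eqn_leq mmin; last by rewrite /=; apply/asboolP.
rewrite ltnNge; apply/negP => m2.
(* Here [m] is 1 or 2; the first and last sets cover in either case, and coincide when [m] is 1. *)
have m0' : (0 < m)%N by [].
have m1' : (m.-1 < m)%N by rewrite prednK.
apply: (no_cover (U (Ordinal m0')) (U (Ordinal m1'))).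
- exact: (Uc _).1.
- exact: (Uc _).1.
- exact: (Uc _).2.
- exact: (Uc _).2.
apply/seteqP; split=> // x _; have : (\bigcup_i U i) x by rewrite Ucov.
move=> [[i im] _ Ux]; have [i0|i0] := eqVneq i 0%N.
  by left; rewrite (_ : Ordinal m0' = Ordinal im)//; apply: val_inj; rewrite /= i0.
right; rewrite (_ : Ordinal m1' = Ordinal im)//; apply: val_inj => /=; lia.
Qed.
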